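(* Let $k$ be a commutative ring and $c'\in k$, and set $\omega:=L(-2)v_0+I_{c'}\in M_k(c',0)$. Then $M_k(c',0)$ is a vertex $k$-algebra generated by $\omega$, with $Y(\omega,z)=\omega(z):=\sum_{n\in\mathbf{Z}}L(n)z^{-n-2}$.
   Context: $\mathrm{Vir}_k$ is the Lie $k$-algebra that is free as a $k$-module on $L(n)$ ($n\in\mathbf{Z}$) and $K$, with brackets $[L(m),L(n)]=(m-n)L(m+n)+\delta_{m+n,0}\binom{m+1}{3}K$ and $[L(m),K]=0$. $\mathrm{Vir}_k^{\ge}$ is the Lie subalgebra spanned by $K$ and $L(m)$, $m\ge 0$. For $c'\in k$, let $U_{c'}=kv_0$ be the free rank one $\mathrm{Vir}_k^{\ge}$-module with $L(m)v_0=0$ ($m\ge 0$) and $Kv_0=c'v_0$, let $\mathrm{Ver}_{c'}$ be the $\mathrm{Vir}_k$-module induced from $U_{c'}$ (Verma module; a free $k$-module with basis $L(-n_1)\cdots L(-n_r)v_0$, $n_1\ge\cdots\ge n_r\ge 1$), let $I_{c'}$ be the $\mathrm{Vir}_k$-submodule generated by $L(-1)v_0$, and $M_k(c',0):=\mathrm{Ver}_{c'}/I_{c'}$, a free $k$-module with basis the images of $L(-n_1)\cdots L(-n_r)v_0$, $n_1\ge\cdots\ge n_r\ge 2$. $L(n)$ also denotes the induced operator on $M_k(c',0)$. The vacuum element of $M_k(c',0)$ is the image of $v_0$. A vertex ring is an additive abelian group $V$ with biadditive products $u(n)v$ for all $n\in\mathbf{Z}$ and a distinguished element $\mathbf{1}\in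 V$ (the vacuum) such that for all $u,v,w\in V$: (a) there is an integer $n_0(u,v)\ge 0$ with $u(n)v=0$ for all $n\ge n_0$; (b) $u(-1)\mathbf{1}=u$ and $u(n)\mathbf{1}=0$ for $n\ge 0$; (c) for all $r,s,t\in\mathbf{Z}$, $\sum_{i\ge 0}\binom{r}{i}(u(t+i)v)(r+s-i)w=\sum_{i\ge 0}(-1)^i\binom{t}{i}\{u(r+t-i)v(s+i)w-(-1)^t v(s+t-i)u(r+i)w\}$. Here $\binom{m}{n}=m(m-1)\cdots(m-n+1)/n!$ for $m\in\mathbf{Z}$, $n\ge 1$, and $\binom{m}{0}=1$. $Y(u,z)=\sum_n u(n)z^{-n-1}$. A vertex $k$-algebra is (equivalently) a vertex ring that is a unital left $k$-module such that all products $u(n)v$ are $k$-bilinear. A subset $S\subseteq V$ generates $V$ if $V$ is generated, as an additive abelian group, by the elements $u_1(i_1)\cdots u_r(i_r)\mathbf{1}$ with $u_j\in S$, $i_j\in\mathbf{Z}$, $r\ge 0$; $V$ is generated by $\omega$ if $S=\{\omega\}$ generates $V$.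
   Formalization: ''Generated by ω'' is taken to mean that M_k(c',0) is the k-span, rather than the additive span, of the elements ω(i_1)...ω(i_r)1; with the additive span the claim fails, e.g. for k = Q, c' = 0, where v_0/2 is not reached. *)

(* Defs.v *)
From HB Require Import structures.
From mathcomp Require Import all_boot all_order all_algebra.
From mathcomp Require Import finmap monalg ring zify.
From mathcomp Require Import boolp classical_sets fsbigop.

Set Implicit Arguments.
Unset Strict Implicit.
Unset Printing Implicit Defensive.

Import GRing.Theory.
Local Open Scope ring_scope.
Local Open Scope quotient_scope.

(* Binomial coefficient m (m - 1) ... (m - n + 1) / n! for m in Z.  The
   integer division is exact. *)
Definition binz (m : int) (n : nat) : int :=
  ((\prod_(i < n) (m - i%:Z)) %/ n`!%:Z)%Z.

Lemma binz3 (m : int) : binz m 3 * 6 = m * (m - 1) * (m - 2).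
Proof.
have two (i : int) : exists q : int, i * (i - 1) = q * 2.
  elim/int_ind: i => [|n [q Hq]|n [q Hq]]; first by exists 0.
  - by exists (q + n%:Z); rewrite mulrDl -Hq intS; ring.
  - by exists (q + n%:Z + 1); rewrite !mulrDl -Hq intS; ring.
have six (i : int) : exists q : int, i * (i - 1) * (i - 2) = q * 6.
  elim/int_ind: i => [|n [q Hq]|n [q Hq]]; first by exists 0.
  - have [p Hp] := two n%:Z; exists (q + p).
    have -> : (q + p) * 6 = q * 6 + p * 2 * 3 by ring.
    rewrite -Hq -Hp intS; ring.
  - have [p Hp] := two (- n.+1%:Z); exists (q - p).
    have -> : (q - p) * 6 = q * 6 - p * 2 * 3 by ring.
    rewrite -Hq -Hp intS; ring.
have [q Hq] := six m.
by rewrite /binz !big_ord_recr big_ord0 /= mul1r subr0 Hq mulzK.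
Qed.
Lemma binz3N (m : int) : binz (- m + 1) 3 = - binz (m + 1) 3.
Proof.
apply: (@mulIf _ (6 : int)) => //; rewrite mulNr !binz3; ring.
Qed.

(* prod u n v is the product u(n)v. *)

Section VertexRing.
Variables (V : zmodType) (prod : V -> int -> V -> V) (one : V).

(* In vr_jacobi the sums over all i >= 0 are sums of finitely supported
   families, by vr_trunc. *)
Record is_vertex_ring : Prop := IsVertexRing {
  vr_addl : forall n u u' v, prod (u + u') n v = prod u n v + prod u' n v;
  vr_addr : forall n u v v', prod u n (v + v') = prod u n v + prod u n v';
  vr_trunc : forall u v, exists n0 : nat,
    forall n : int, (n0%:Z <= n)%R -> prod u n v = 0;
  vr_creation : forall u, prod u (-1) one = u;
  vr_vacuum : forall u (n : int), (0 <= n)%R -> prod u n one = 0;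
  vr_jacobi : forall u v w (r s t : int),
    \sum_(i \in [set: nat])
       prod (prod u (t + i%:Z) v) (r + s - i%:Z) w *~ binz r i
    = \sum_(i \in [set: nat])
       (prod u (r + t - i%:Z) (prod v (s + i%:Z) w)
        - prod v (s + t - i%:Z) (prod u (r + i%:Z) w) *~ (-1) ^ t)
       *~ ((-1) ^+ i * binz t i) }.

(* The coefficient of z^j in Y(u, z) = sum_n u(n) z^(-n-1). *)
Definition Y (u : V) (j : int) : V -> V := prod u (- j - 1).

End VertexRing.

Section Submodule.
Variables (k : pzRingType) (V : lmodType k).

(* The k-submodule generated by G and stable under all the maps act o. *)
Inductive gen_submod (O : Type) (act : O -> V -> V) (G : V -> Prop)
    : V -> Prop :=
| gen_submod_gen v of G v : gen_submod act G v
| gen_submod0 : gen_submod act G 0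
| gen_submodD u v of gen_submod act G u & gen_submod act G v :
    gen_submod act G (u + v)
| gen_submodZ a v of gen_submod act G v : gen_submod act G (a *: v)
| gen_submod_act o v of gen_submod act G v : gen_submod act G (act o v).

Definition span : (V -> Prop) -> V -> Prop :=
  gen_submod (fun (o : void) _ => of_void V o).

End Submodule.

Section VertexAlgebra.
Variables (k : comPzRingType) (V : lmodType k).
Variables (prod : V -> int -> V -> V) (one : V).

Record is_vertex_algebra : Prop := IsVertexAlgebra {
  va_vertex_ring : is_vertex_ring prod one;
  va_scalel : forall n a u v, prod (a *: u) n v = a *: prod u n v;
  va_scaler : forall n a u v, prod u n (a *: v) = a *: prod u n v }.

(* u_1(i_1) ... u_r(i_r) 1 for s = [:: (u_1, i_1); ...; (u_r, i_r)]. *)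
Definition iter_prod (s : seq (V * int)) : V :=
  foldr (fun p v => prod p.1 p.2 v) one s.

(* Generation as a vertex k-algebra: V is the k-span of the elements
   u_1(i_1) ... u_r(i_r) 1 with all u_j in S.  For k = Z this is their additive
   span, i.e. generation as a vertex ring; over a general k the additive span
   is too small (for k = Q and c' = 0 it does not even contain every rational
   multiple of the vacuum of M_k(c', 0)). *)
Definition generates (S : V -> Prop) : Prop :=
  forall v : V, span (fun x => exists2 s : seq (V * int),
    (forall p, p \in s -> S p.1) & x = iter_prod s) v.

End VertexAlgebra.

(* The Lmodule instance of monalg requires a nonzero ring, which is not assumed
   here; hence the alias kfree. *)

Section FreeModule.
Variables (k : pzRingType) (X : choiceType).

Definition kfree : Type := malg X k.
HB.instance Definition _ := GRing.Zmodule.on kfree.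

Definition kscale (a : k) (g : malg X k) : malg X k :=
  \sum_(x <- msupp g) << a * g@_x *g x >>.

Lemma kscaleE a g x : (kscale a g)@_x = a * g@_x.
Proof.
rewrite /kscale {3}[g]monalgE !raddf_sum mulr_sumr /=.
by apply/eq_bigr=> /= i _; rewrite !mcoeffU mulrnAr.
Qed.

Fact kscaleA a b g : kscale a (kscale b g) = kscale (a * b) g.
Proof. by apply/malgP=> x; rewrite !kscaleE mulrA. Qed.
Fact kscale1 : left_id 1 kscale.
Proof. by move=> g; apply/malgP=> x; rewrite !kscaleE mul1r. Qed.
Fact kscaleDr : right_distributive kscale +%R.
Proof. by move=> a g h; apply/malgP=> x; rewrite !(mcoeffD, kscaleE) mulrDr. Qed.
Fact kscaleDl g : {morph kscale^~ g : a b / a + b}.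
Proof. by move=> a b; apply/malgP=> x; rewrite !(mcoeffD, kscaleE) mulrDl. Qed.

HB.instance Definition _ :=
  GRing.Zmodule_isLmodule.Build k kfree kscaleA kscale1 kscaleDr kscaleDl.

Definition kbasis (x : X) : kfree := << 1 *g x >>.

Definition kext (V : lmodType k) (f : X -> V) (g : kfree) : V :=
  \sum_(x <- msupp g) g@_x *: f x.

Lemma kcoeffZ a (g : kfree) x : mcoeff x (a *: g) = a * mcoeff x g.
Proof. exact: kscaleE. Qed.

Lemma kextEw (V : lmodType k) (f : X -> V) (g : kfree) (D : {fset X}) :
  (msupp g `<=` D)%fset -> kext f g = \sum_(x <- D) g@_x *: f x.
Proof.
move=> le_gD; rewrite (big_fsetID _ (mem (msupp g))) /=.
rewrite [X in _ + X]big1_fset ?addr0.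
  rewrite /kext; apply: eq_fbigl => x; rewrite !inE /=.
  by case xg: (x \in msupp g); rewrite ?andbF // (fsubsetP le_gD).
by move=> x; rewrite !inE /= => /andP[_ /mcoeff_outdom->]; rewrite scale0r.
Qed.

Lemma kext_is_linear (V : lmodType k) (f : X -> V) : linear (kext f).
Proof.
move=> a g h.
pose D := (msupp g `|` (msupp h `|` msupp (a *: g + h)))%fset.
have gD : (msupp g `<=` D)%fset by exact: fsubsetUl.
have hD : (msupp h `<=` D)%fset.
  by apply: fsubset_trans (fsubsetUr _ _); exact: fsubsetUl.
have ghD : (msupp (a *: g + h) `<=` D)%fset.
  by apply: fsubset_trans (fsubsetUr _ _); exact: fsubsetUr.
rewrite (kextEw f gD) (kextEw f hD) (kextEw f ghD).
rewrite scaler_sumr -big_split /=; apply: eq_bigr => x _.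
by rewrite mcoeffD kcoeffZ scalerDl scalerA.
Qed.

HB.instance Definition _ (V : lmodType k) (f : X -> V) :=
  GRing.isLinear.Build k kfree V *:%R (kext f) (kext_is_linear f).

Lemma kfree_ind (P : kfree -> Prop) :
  P 0 -> (forall a x g, P g -> P (a *: kbasis x + g)) -> forall g, P g.
Proof.
move=> P0 PD g; rewrite [g]monalgE; elim: (enum_fset _) => [|x r IHr].
  by rewrite big_nil.
rewrite big_cons (_ : << _ *g x >> = g@_x *: kbasis x); first exact: PD.
by apply/malgP => y; rewrite kcoeffZ !mcoeffU mulrnAr mulr1.
Qed.

Lemma kext_basis (V : lmodType k) (f : X -> V) x : kext f (kbasis x) = f x.
Proof.
by rewrite (kextEw f msuppU_le) big_seq_fset1 mcoeffUU scale1r.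
Qed.

End FreeModule.

Section Quotient.
Variables (k : pzRingType) (V : lmodType k).
Variables (O : Type) (act : O -> V -> V) (G : V -> Prop).

Definition in_submod : {pred V} := fun v => `[< gen_submod act G v >].

Fact in_submod_zmod_closed : zmod_closed in_submod.
Proof.
split=> [|u v]; first exact/asboolP/gen_submod0.
move=> /asboolP Gu /asboolP Gv; apply/asboolP/gen_submodD => //.
by rewrite -scaleN1r; apply: gen_submodZ.
Qed.
HB.instance Definition _ :=
  GRing.isZmodClosed.Build V in_submod in_submod_zmod_closed.

Definition kquot : Type := Quotient.quot (in_submod : zmodClosed V).
HB.instance Definition _ := GRing.Zmodule.on kquot.
HB.instance Definition _ : EqQuotient V (Quotient.equiv in_submod) kquot :=
  EqQuotient.on kquot.

Definition kproj (v : V) : kquot := \pi_kquot v.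

Lemma kproj_eq u v : (kproj u = kproj v) <-> gen_submod act G (u - v).
Proof.
split=> [/eqP | Guv].
  by rewrite eqmodE /= => /asboolP.
by apply/eqP; rewrite eqmodE; apply/asboolP.
Qed.

Lemma kprojD u v : kproj (u + v) = kproj u + kproj v.
Proof. exact: (Quotient.pi_add in_submod u v). Qed.

Definition qscale (a : k) (q : kquot) : kquot := kproj (a *: repr q).

Lemma kprojK q : kproj (repr q) = q.
Proof. exact: reprK. Qed.

Lemma qscaleE a v : qscale a (kproj v) = kproj (a *: v).
Proof.
apply/kproj_eq; rewrite -scalerBr; apply: gen_submodZ.
by apply/kproj_eq; rewrite kprojK.
Qed.

Fact qscaleA a b q : qscale a (qscale b q) = qscale (a * b) q.
Proof. by rewrite -(kprojK q) !qscaleE scalerA. Qed.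
Fact qscale1 : left_id 1 qscale.
Proof. by move=> q; rewrite -(kprojK q) !qscaleE scale1r. Qed.
Fact qscaleDr : right_distributive qscale +%R.
Proof.
by move=> a p q; rewrite -(kprojK p) -(kprojK q) -kprojD !qscaleE scalerDr kprojD.
Qed.
Fact qscaleDl q : {morph qscale^~ q : a b / a + b}.
Proof. by move=> a b; rewrite -(kprojK q) !qscaleE scalerDl kprojD. Qed.

HB.instance Definition _ :=
  GRing.Zmodule_isLmodule.Build k kquot qscaleA qscale1 qscaleDr qscaleDl.

Lemma kproj_is_linear : linear kproj.
Proof. by move=> a u v; rewrite kprojD -qscaleE. Qed.
HB.instance Definition _ :=
  GRing.isLinear.Build k V kquot *:%R kproj kproj_is_linear.

(* The endomorphism of the quotient induced by f, when f preserves the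
   submodule; see qmapE. *)
Definition qmap (f : V -> V) (q : kquot) : kquot := kproj (f (repr q)).

Lemma qmapE (f : {linear V -> V}) v :
  (forall u, gen_submod act G u -> gen_submod act G (f u)) ->
  qmap f (kproj v) = kproj (f v).
Proof.
move=> Gf; apply/kproj_eq; rewrite -linearB; apply: Gf.
by apply/kproj_eq; rewrite kprojK.
Qed.

End Quotient.

Section Lie.
Variables (k : comPzRingType) (g : lmodType k) (br : g -> g -> g).

Record is_lie_algebra : Prop := IsLieAlgebra {
  lie_linearl : forall y, linear (br^~ y);
  lie_linearr : forall x, linear (br x);
  lie_alternating : forall x, br x x = 0;
  lie_jacobi : forall x y z,
    br x (br y z) + br y (br z x) + br z (br x y) = 0 }.

End Lie.

Section LieBasis.
Variables (k : comPzRingType) (g : lmodType k) (br : g -> g -> g).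
Variables (X : Type) (e : X -> g).
Hypothesis e_ind : forall P : g -> Prop,
  P 0 -> (forall a x u, P u -> P (a *: e x + u)) -> forall u, P u.
Hypothesis brl : forall y, linear (br^~ y).
Hypothesis brr : forall x, linear (br x).
Let br0l y : br 0 y = 0.
Proof. by have := brl y (-1) 0 0; rewrite /= scaler0 addr0 scaleN1r addNr. Qed.
Let br0r y : br y 0 = 0.
Proof. by have := brr y (-1) 0 0; rewrite /= scaler0 addr0 scaleN1r addNr. Qed.
Let brDl a u v y : br (a *: u + v) y = a *: br u y + br v y.
Proof. exact: brl. Qed.

Lemma lie_from_basis :
  (forall x, br (e x) (e x) = 0) ->
  (forall x y, br (e x) (e y) = - br (e y) (e x)) ->
  (forall x y z, br (e x) (br (e y) (e z)) + br (e y) (br (e z) (e x))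
     + br (e z) (br (e x) (e y)) = 0) ->
  is_lie_algebra br.
Proof.
move=> alt anti jac.
have antiV x y : br x y = - br y x.
  elim/e_ind: x y => [|a b x IHx] y; first by rewrite br0l br0r oppr0.
  rewrite brDl brr IHx opprD -scalerN; congr (_ *: _ + _).
  elim/e_ind: y => [|a' b' y IHy]; first by rewrite br0l br0r oppr0.
  by rewrite brDl brr IHy opprD -scalerN anti.
have E d a b c a' b' c' : a + b + c = 0 -> a' + b' + c' = 0 ->
    (d *: a + a') + (d *: b + b') + (d *: c + c') = 0 :> g.
  move=> h h'; rewrite [X in X + _]addrACA -scalerDr addrACA -scalerDr.
  by rewrite h h' scaler0 addr0.
split=> // [x|x y z].
  elim/e_ind: x => [|a b x IHx]; first exact: br0l.
  by rewrite brDl !brr IHx alt scaler0 add0r addr0 [br x _]antiV scalerN subrr.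
elim/e_ind: x => [|d b x IHx]; first by rewrite !(br0l, br0r) !addr0.
rewrite !(brDl, brr); apply: (E) => //; clear x IHx.
elim/e_ind: y => [|d' b' y IHy]; first by rewrite !(br0l, br0r) !addr0.
rewrite !(brDl, brr); apply: (E) => //; clear y IHy.
elim/e_ind: z => [|d'' b'' z IHz]; first by rewrite !(br0l, br0r) !addr0.
by rewrite !(brDl, brr); apply: E.
Qed.
End LieBasis.

Section Induced.
Variables (k : comPzRingType) (g : lmodType k) (br : g -> g -> g).
Variables (h : g -> Prop) (W : lmodType k) (rho : g -> W -> W).

(* For a Lie subalgebra h of g acting on W through rho (only the values rho x
   for x in h matter), the induced module is U(g) (x)_U(h) W.  Writing U(g) as
   the quotient of the tensor algebra of g, this is the quotient of the free
   k-module on the symbols x_1 ... x_r (x) w, represented by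
   tens [:: x_1; ...; x_r] w, by the following relations: multilinearity in
   the x_i and w; xy - yx = [x, y] inside a word; and balancedness
   (s x) (x) w = s (x) (x w) for x in h (it is enough to impose it on h, which
   generates U(h)). *)
Definition tens (s : seq g) (w : W) : kfree k (seq g * W)%type :=
  kbasis k (s, w).

Inductive ind_rel : kfree k (seq g * W)%type -> Prop :=
| ind_addl s x y t w : ind_rel
    (tens (s ++ (x + y) :: t) w - tens (s ++ x :: t) w - tens (s ++ y :: t) w)
| ind_scalel s a x t w : ind_rel
    (tens (s ++ (a *: x) :: t) w - a *: tens (s ++ x :: t) w)
| ind_addr s w w' : ind_rel (tens s (w + w') - tens s w - tens s w')
| ind_scaler s a w : ind_rel (tens s (a *: w) - a *: tens s w)
| ind_bracket s x y t w : ind_rel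
    (tens (s ++ [:: x, y & t]) w - tens (s ++ [:: y, x & t]) w
     - tens (s ++ br x y :: t) w)
| ind_balanced s x w of h x : ind_rel
    (tens (rcons s x) w - tens s (rho x w)).

Definition induced : lmodType k :=
  kquot (fun (o : void) _ => of_void (kfree k (seq g * W)%type) o) ind_rel.

Definition ind_tens (s : seq g) (w : W) : induced := kproj _ _ (tens s w).

(* Left multiplication by x : g, namely x (s (x) w) = (x s) (x) w. *)
Definition word_act (x : g) :
    kfree k (seq g * W)%type -> kfree k (seq g * W)%type :=
  kext (fun p : seq g * W => tens (x :: p.1) p.2).
Definition ind_act (x : g) : induced -> induced := qmap (word_act x).

HB.instance Definition _ x := GRing.Linear.on (word_act x).

Lemma word_act_tens x s w : word_act x (tens s w) = tens (x :: s) w.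
Proof. exact: kext_basis. Qed.

Lemma word_act_stable x u : span ind_rel u -> span ind_rel (word_act x u).
Proof.
elim=> [v Rv||v w _ IHv _ IHw|a v _ IHv|[] //].
- apply: gen_submod_gen; case: Rv => *.
  + by rewrite !linearB /= !word_act_tens -!cat_cons; apply: ind_addl.
  + by rewrite linearB linearZ /= !word_act_tens -!cat_cons; apply: ind_scalel.
  + by rewrite !linearB /= !word_act_tens; apply: ind_addr.
  + by rewrite linearB linearZ /= !word_act_tens; apply: ind_scaler.
  + by rewrite !linearB /= !word_act_tens -!cat_cons; apply: ind_bracket.
  + by rewrite linearB /= !word_act_tens -rcons_cons; apply: ind_balanced.
- by rewrite linear0; apply: gen_submod0.
- by rewrite linearD; apply: gen_submodD.
- by rewrite linearZ; apply: gen_submodZ.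
Qed.

Lemma ind_actE x u : ind_act x (kproj _ _ u) = kproj _ _ (word_act x u).
Proof. exact/qmapE/word_act_stable. Qed.

Lemma ind_act_is_linear x : linear (ind_act x).
Proof.
move=> a u v; rewrite -(kprojK u) -(kprojK v) -linearP !ind_actE.
by rewrite linearP /= linearP.
Qed.
HB.instance Definition _ x :=
  GRing.isLinear.Build k induced induced *:%R (ind_act x)
    (ind_act_is_linear x).

End Induced.

Section VirasoroJacobi.
Variables (k : comPzRingType) (V : lmodType k) (L : int -> V) (K : V)
  (br : V -> V -> V).
Hypothesis brr : forall x, linear (br x).
Hypothesis brK : forall x, br x K = 0.
Hypothesis brL : forall m n, br (L m) (L n) =
  (m - n)%:~R *: L (m + n)
  + (if m + n == 0 then (binz (m + 1) 3)%:~R *: K else 0).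
Lemma jacL m n p :
  br (L m) (br (L n) (L p)) + br (L n) (br (L p) (L m))
  + br (L p) (br (L m) (L n)) = 0.
Proof.
have b0 x : br x 0 = 0.
  by have := brr x (-1) 0 0; rewrite /= scaler0 addr0 scaleN1r addNr.
have brZ x a u : br x (a *: u) = a *: br x u.
  by have := brr x a u 0; rewrite b0 !addr0.
have brD x u v : br x (u + v) = br x u + br x v.
  by have := brr x 1 u v; rewrite !scale1r.
have brI x b a : br x (if b then a *: K else 0) = 0.
  case: b; first by rewrite brZ brK scaler0.
  exact: b0.
rewrite (brL n p) (brL p m) (brL m n) !brD !brI !addr0 !brZ !brL.
have -> : n + (p + m) = m + (n + p) by ring.
have -> : p + (m + n) = m + (n + p) by ring.
rewrite !scalerDr !scalerA -!intrM.
have E (a b c u v w: int) (T : V) (A : bool) : a + b + c = 0 ->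
   (A -> u + v + w = 0) ->
  (a%:~R *: T + (if A then u%:~R *: K else 0)) + (b%:~R *: T +
   (if A then v%:~R *: K else 0)) + (c%:~R *: T + (if A then w%:~R *: K else 0)) = 0.
  move=> h h'; rewrite [X in X + _]addrACA -scalerDl -intrD addrACA -scalerDl -intrD h scale0r add0r.
  by case: A h' => [h'|_]; rewrite ?addr0 // -!scalerDl -!intrD h' ?scale0r.
have I (a b : int) (A : bool) : b%:~R *: (if A then a%:~R *: K else 0)
    = if A then (b * a)%:~R *: K else 0.
  by case: A; rewrite ?scaler0 // scalerA intrM.
rewrite !I; apply: E; first by ring.
move=> /eqP h; apply: (@mulIf _ (6 : int)) => //.
rewrite mul0r !mulrDl -!mulrA !binz3.
have -> : p = - m - n by lia.
ring.
Qed.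

Lemma jacLK (e : option int -> V) : e None = K -> (forall n, e (Some n) = L n) ->
  (forall x, br K x = 0) -> forall b b' b'',
  br (e b) (br (e b') (e b'')) + br (e b') (br (e b'') (e b))
  + br (e b'') (br (e b) (e b')) = 0.
Proof.
move=> eK eL brKl.
have b0 x : br x 0 = 0.
  by have := brr x (-1) 0 0; rewrite /= scaler0 addr0 scaleN1r addNr.
move=> [m|] [n|] [p|]; rewrite ?eL ?eK; first exact: jacL.
all: by rewrite ?(brK, brKl, b0, addr0).
Qed.
End VirasoroJacobi.

Section Virasoro.
Variable k : comPzRingType.

(* The basis: Some n stands for L(n) and None for K. *)
Definition Vir : lmodType k := kfree k (option int).

Definition VirL (n : int) : Vir := kbasis k (Some n).
Definition VirK : Vir := kbasis k None.

Definition vir_basis_br (x y : option int) : Vir :=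
  match x, y with
  | Some m, Some n =>
      (m - n)%:~R *: VirL (m + n)
      + (if m + n == 0 then (binz (m + 1) 3)%:~R *: VirK else 0)
  | _, _ => 0
  end.

Definition vir_br (x y : Vir) : Vir :=
  kext (fun b => kext (fun b' => vir_basis_br b b') y) x.

Lemma vir_br_basisl b y : vir_br (kbasis k b) y = kext (vir_basis_br b) y.
Proof. by rewrite /vir_br kext_basis. Qed.
Lemma vir_br_basis b b' : vir_br (kbasis k b) (kbasis k b') = vir_basis_br b b'.
Proof. by rewrite vir_br_basisl kext_basis. Qed.

Fact vir_br_linearl y : linear (vir_br^~ y).
Proof. by move=> a u v; rewrite /vir_br linearP. Qed.

Fact vir_br_linearr x : linear (vir_br x).
Proof.
have aux (V : lmodType k) (a b : k) (p q r s : V) :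
    b *: (a *: p + q) + (a *: r + s) = a *: (b *: p + r) + (b *: q + s).
  by rewrite !scalerDr !scalerA [b * a]mulrC addrACA.
have vir_br0 y : vir_br 0 y = 0 by rewrite /vir_br linear0.
move=> a u v; elim/kfree_ind: x => [|b e x IHx].
  by rewrite !vir_br0 scaler0 addr0.
by rewrite !vir_br_linearl IHx !vir_br_basisl linearP; apply: aux.
Qed.

Lemma vir_br_LL m n : vir_br (VirL m) (VirL n) =
  (m - n)%:~R *: VirL (m + n)
  + (if m + n == 0 then (binz (m + 1) 3)%:~R *: VirK else 0).
Proof. exact: vir_br_basis. Qed.

Lemma vir_br_K x : vir_br x VirK = 0.
Proof.
elim/kfree_ind: x => [|a b x IHx]; first by rewrite /vir_br linear0.
by rewrite vir_br_linearl /= IHx vir_br_basis; case: b => [m|]; rewrite scaler0 addr0.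
Qed.

Lemma vir_is_lie_algebra : is_lie_algebra vir_br.
Proof.
apply: (lie_from_basis (kfree_ind (X := option int) (k := k))).
- exact: vir_br_linearl.
- exact: vir_br_linearr.
- move=> b; rewrite vir_br_basis; case: b => [m|] //=.
  rewrite subrr scale0r add0r; case: eqP => // mm.
  have -> : m = 0 by lia.
  have aux (i : int) : i = - i -> i = 0 by lia.
  have -> : binz (0 + 1) 3 = 0 by apply: aux; rewrite -{1}oppr0; exact: binz3N.
  by rewrite scale0r.
- move=> b b'; rewrite !vir_br_basis; case: b b' => [m|] [n|] /=.
  all: rewrite ?oppr0 //.
  rewrite opprD -scaleNr -rmorphN opprB [n + m]addrC; congr (_ + _).
  case: eqP => [mn|]; rewrite ?oppr0 //.
  rewrite -scaleNr -rmorphN -binz3N (_ : - n = m) //; lia.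
- have brKl x : vir_br VirK x = 0.
    rewrite vir_br_basisl; elim/kfree_ind: x => [|a b x IHx].
      by rewrite linear0.
    by rewrite linearP /= IHx kext_basis scaler0 addr0.
  exact: (jacLK vir_br_linearr vir_br_K vir_br_LL).
Qed.

Definition Vir_ge : Vir -> Prop :=
  span (fun x => x = VirK \/ exists2 m : int, (0 <= m)%R & x = VirL m).

Variable c : k.

(* The action of Vir_ge on U_c = k v0: L(m) v0 = 0 and K v0 = c v0. *)
Definition U_act (x : Vir) (w : k^o) : k^o :=
  kext (fun b : option int => if b is Some _ then 0 : k^o else c *: w) x.

Definition Ver : lmodType k := induced vir_br Vir_ge U_act.

Definition ver_act : Vir -> Ver -> Ver :=
  @ind_act k Vir vir_br Vir_ge k^o U_act.
Definition ver_v0 : Ver := ind_tens vir_br Vir_ge U_act [::] (1 : k^o).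

(* The quotient by the Vir-submodule generated by L(-1) v0. *)
Definition VirM : lmodType k :=
  kquot ver_act (fun v => v = ver_act (VirL (-1)) ver_v0).

Definition M_proj : Ver -> VirM := @kproj k Ver Vir ver_act _.

(* The operator L(n) on M_k(c, 0). *)
Definition M_L (n : int) : VirM -> VirM := qmap (ver_act (VirL n)).

Lemma M_LE n v : M_L n (M_proj v) = M_proj (ver_act (VirL n) v).
Proof.
apply: (@qmapE k Ver Vir ver_act _ (@ind_act k Vir vir_br Vir_ge k^o U_act (VirL n))).
exact: gen_submod_act.
Qed.

Definition M_vac : VirM := M_proj ver_v0.
Definition M_omega : VirM := M_proj (ver_act (VirL (-2)) ver_v0).

(* The coefficient of z^j in omega(z) = sum_n L(n) z^(-n-2). *)
Definition omega_field (j : int) : VirM -> VirM := M_L (- j - 2).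

End Virasoro.

(* Main.v *)
(* Write V = M_k(c', 0) and call a field a family a(n) of endomorphisms of V with
   a(n)w = 0 for n large.  For fields a, b with
   [a(m), b(n)] = sum_l binom(m, l) d_l(m + n - l), the n-th products satisfy
   [a_(m), b_(n)] c = sum_l binom(m, l) (d_l)_(m + n - l) c for every field c, local
   to a and b or not.  With a = b = omega(z) this makes the space of all fields a
   Virasoro module, L(n) acting as omega_(n + 1), and id is a vector in it killed by
   L(n) for n >= -1.  The universal property of V yields Y : V -> {fields} with
   Y(vacuum) = id, so no uniqueness theorem, locality or torsion-freeness is needed
   to define Y.  The Jacobi identity for (u, v) says
   (z^r Y(u))_(t) Y(v) = sum_i binom(r, i) z^(r - i) Y(u(t + i)v).  By the same
   commutator formula it passes from v to omega(p)v, given the identities for u and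
   the omega(l)u (l >= 0) with v and the commutators [omega(m), u(n)].  This gives
   it first for u = omega, where omega(l)u is a derivative of omega, a multiple of
   omega or of the vacuum; its t = 0 case supplies the commutators for every u, and
   a second induction on v proves it in general. *)
Require Import Defs.
From mathcomp Require Import all_boot all_order all_algebra.
From HB Require Import structures.
From mathcomp Require Import ring zify.
From mathcomp Require Import boolp classical_sets fsbigop.

Set Implicit Arguments.
Unset Strict Implicit.
Unset Printing Implicit Defensive.

Import Order.TTheory GRing.Theory Num.Theory.
Local Open Scope ring_scope.

#[local] Obligation Tactic := idtac.

(** * Integer binomial coefficients *)

Definition ffactz (m : int) (n : nat) : int := \prod_(i < n) (m - i%:Z).

Lemma ffactz0 m : ffactz m 0 = 1.
Proof. by rewrite /ffactz big_ord0. Qed.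

Lemma ffactzSr m n : ffactz m n.+1 = ffactz m n * (m - n%:Z).
Proof. by rewrite /ffactz big_ord_recr. Qed.

Lemma ffactzS m n : ffactz m n.+1 = m * ffactz (m - 1) n.
Proof.
rewrite /ffactz big_ord_recl subr0; congr (_ * _).
by apply: eq_bigr => i _; rewrite /= /bump /= add1n intS; ring.
Qed.

Lemma ffactzD m i j : ffactz m (i + j) = ffactz m i * ffactz (m - i%:Z) j.
Proof.
elim: j => [|j IHj]; first by rewrite addn0 ffactz0 mulr1.
by rewrite addnS !ffactzSr IHj PoszD; ring.
Qed.

Lemma ffactz_pascal m n :
  ffactz (m + 1) n.+1 = ffactz m n.+1 + ffactz m n * n.+1%:Z.
Proof. by rewrite ffactzS addrK ffactzSr intS; ring. Qed.

(** Induction on n, then on m in both directions by Pascal's rule, whose extra term is divisible by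
    the hypothesis for n. The division in [binz] is thus exact, and later identities are checked
    after multiplying by factorials and cancelling in Z. *)
Lemma fact_dvd_ffactz m n : (n`!%:Z %| ffactz m n)%Z.
Proof.
elim: n m => [|n IHn] m; first by rewrite dvd1z.
have dvdn m' : (n.+1`!%:Z %| ffactz m' n * n.+1%:Z)%Z.
  by rewrite factS mulnC PoszM dvdz_mul.
elim/int_ind: m => [|m IHm|m IHm]; first by rewrite ffactzS mul0r dvdz0.
- by rewrite intS addrC ffactz_pascal rpredD.
- move: IHm; rewrite (_ : - m%:Z = - m.+1%:Z + 1); last by rewrite intS; ring.
  by rewrite ffactz_pascal rpredDr.
Qed.

Lemma binz_fact m n : binz m n * n`!%:Z = ffactz m n.
Proof. by rewrite /binz divzK // fact_dvd_ffactz. Qed.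

Lemma factz_neq0 n : n`!%:Z != 0.
Proof. by rewrite -lt0n fact_gt0. Qed.

Lemma binz0 m : binz m 0 = 1.
Proof. by apply: (mulIf (factz_neq0 0)); rewrite binz_fact ffactz0. Qed.

Lemma binz1 m : binz m 1 = m.
Proof. by apply: (mulIf (factz_neq0 1)); rewrite binz_fact ffactzS ffactz0. Qed.

Lemma binz_pascal m n : binz (m + 1) n.+1 = binz m n.+1 + binz m n.
Proof.
apply: (mulIf (factz_neq0 n.+1)); rewrite mulrDl !binz_fact ffactz_pascal.
by rewrite -(binz_fact m n) factS PoszM; ring.
Qed.

Lemma binz_absorb m n : binz m n.+1 * n.+1%:Z = m * binz (m - 1) n.
Proof.
apply: (mulIf (factz_neq0 n)); rewrite -mulrA -PoszM -factS binz_fact ffactzS.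
by rewrite -binz_fact mulrA.
Qed.

Lemma binz_absorbr m n : binz m n * (m - n%:Z) = m * binz (m - 1) n.
Proof.
apply: (mulIf (factz_neq0 n)).
by rewrite mulrAC binz_fact -mulrA binz_fact -ffactzS ffactzSr.
Qed.

Lemma binz_nat (m n : nat) : binz m n = 'C(m, n).
Proof.
elim: m n => [|m IHm] [|n]; rewrite ?binz0 ?bin0 //.
  by apply: (mulIf (factz_neq0 n.+1)); rewrite binz_fact ffactzS !mul0r.
by rewrite intS addrC binz_pascal !IHm binS.
Qed.

Lemma binz_small (m : int) n : 0 <= m -> m < n%:Z -> binz m n = 0.
Proof. by case: m => // m _ lt_mn; rewrite binz_nat bin_small. Qed.

(** Multiplied by i! j!, both sides become the falling factorial of length i + j. *)
Lemma binz_mul m i j : binz m i * binz (m - i%:Z) j = binz m j * binz (m - j%:Z) i.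
Proof.
apply: (mulIf (factz_neq0 i)); apply: (mulIf (factz_neq0 j)).
have E a b : binz m a * binz (m - a%:Z) b * a`!%:Z * b`!%:Z = ffactz m (a + b).
  by rewrite ffactzD -!binz_fact; ring.
by rewrite E mulrAC E addnC.
Qed.

(** Trinomial revision: i! j! times either side is again [ffactz m (i + j)]. *)
Lemma binz_mul_nat m i j :
  binz m (i + j) * binz (i + j)%N%:Z j = binz m j * binz (m - j%:Z) i.
Proof.
apply: (mulIf (factz_neq0 j)); apply: (mulIf (factz_neq0 i)).
have E : 'C(i + j, j)%:Z * j`!%:Z * i`!%:Z = (i + j)`!%:Z.
  by rewrite -!PoszM -mulnA -(bin_fact (leq_addl i j)) addnK.
transitivity (binz m (i + j) * (i + j)`!%:Z); first by rewrite -E binz_nat; ring.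
rewrite binz_fact addnC ffactzD -!binz_fact; ring.
Qed.

Lemma binzN m n : binz (- m) n = (-1) ^+ n * binz (m + n%:Z - 1) n.
Proof.
apply: (mulIf (factz_neq0 n)); rewrite -mulrA !binz_fact.
elim: n => [|n IHn]; first by rewrite !ffactz0.
rewrite ffactzSr IHn ffactzS exprS intS.
rewrite (_ : m + (1 + n%:Z) - 1 - 1 = m + n%:Z - 1); ring.
Qed.

(** Induction on s. After multiplication by s + 1, written as i + (s + 1 - i) in the i-th term, each
    part is absorbed into one of the two binomials. *)
Lemma vandermonde m n s :
  binz (m + n) s = \sum_(i < s.+1) binz m i * binz n (s - i)%N.
Proof.
elim: s m n => [|s IHs] m n; first by rewrite big_ord1 !binz0.
apply: (@mulIf _ s.+1%:Z) => //; rewrite binz_absorb mulrDl mulr_suml.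
rewrite {1}(_ : m + n - 1 = m - 1 + n); last by ring.
rewrite (_ : m + n - 1 = m + (n - 1)); last by ring.
pose F (i : nat) := i%:Z * binz m i * binz n (s.+1 - i)%N.
pose G (i : nat) := (s.+1 - i)%N%:Z * binz m i * binz n (s.+1 - i)%N.
rewrite (eq_bigr (fun i : 'I_s.+2 => F i + G i)); last first.
  by move=> [i /= lt_is] _; rewrite /F /G -subzn //; ring.
rewrite big_split /= !IHs !mulr_sumr [X in _ = X + _]big_ord_recl /F /= !mul0r add0r.
rewrite [X in _ = _ + X]big_ord_recr /G /= subnn !mul0r addr0.
congr (_ + _); apply: eq_bigr => [[i /= lt_is]] _.
  by rewrite /bump /= add1n subSS mulrA -binz_absorb; ring.
by rewrite subSn // mulrCA -binz_absorb; ring.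
Qed.

(** Vandermonde after negating the upper index: binom(p, m) = (-1)^m binom(m - 1 - p, m), and m - 1
    - p splits as N + (m - 1 - p - N). This is the coefficient identity behind the Leibniz rules
    below. *)
Lemma vandermonde_alt (N p : int) (m : nat) :
  \sum_(i < m.+1) (-1) ^+ i * binz N i * binz (N + p - i%:Z) (m - i)%N = binz p m.
Proof.
have E q : binz q m = (-1) ^+ m * binz (m%:Z - 1 - q) m.
  by rewrite -{1}[q]opprK binzN; congr (_ * binz _ _); ring.
rewrite E (_ : m%:Z - 1 - p = N + (m%:Z - 1 - p - N)); last by ring.
rewrite vandermonde mulr_sumr; apply: eq_bigr => [[i /= lt_im]] _.
rewrite -{1}[N + p - i%:Z]opprK binzN.
rewrite (_ : - (N + p - i%:Z) + (m - i)%N%:Z - 1 = m%:Z - 1 - p - N); last first.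
  by rewrite -subzn //; ring.
rewrite -[X in (-1) ^+ X * (_ * _)](@subnK i m) // exprD; ring.
Qed.

(** * Finitely supported infinite sums *)

Section InfiniteSums.
Variable V : zmodType.
Implicit Types (f g : nat -> V) (F : nat -> nat -> V).

(** Over an infinite support this sum defaults to 0, hence the [fin_supp] hypotheses of the
    additivity lemmas. *)
Definition isum f : V := \sum_(i \in [set: nat]) f i.

Definition fin_supp f := exists N : nat, forall i, (N <= i)%N -> f i = 0.

Lemma isumE N f : (forall i, (N <= i)%N -> f i = 0) -> isum f = \sum_(i < N) f i.
Proof.
move=> f0; rewrite fsbig_ord; apply/esym/fsbig_widen => // i [_ /=].
by move/negP; rewrite -leqNgt => /f0.
Qed.

Lemma eq_isum f g : f =1 g -> isum f = isum g.
Proof. by move=> fg; apply: eq_fsbigr => i _. Qed.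

Lemma isum0 f : (forall i, f i = 0) -> isum f = 0.
Proof. by move=> f0; rewrite (@isumE 0) ?big_ord0. Qed.

Lemma isum1 j f : (forall i, i != j -> f i = 0) -> isum f = f j.
Proof.
move=> f0; rewrite (@isumE j.+1) => [|i lt_ji]; last by rewrite f0 ?gtn_eqF.
rewrite big_ord_recr /= big1 ?add0r // => i _; rewrite f0 // ltn_eqF //.
Qed.

Lemma fin_suppD f g : fin_supp f -> fin_supp g -> fin_supp (fun i => f i + g i).
Proof.
move=> [M fM] [N gN]; exists (maxn M N) => i; rewrite geq_max => /andP[Mi Ni].
by rewrite fM // gN // addr0.
Qed.

Lemma isumD f g : fin_supp f -> fin_supp g ->
  isum (fun i => f i + g i) = isum f + isum g.
Proof.
move=> [M fM] [N gN].
rewrite !(@isumE (maxn M N)) ?big_split // => i; rewrite geq_max => /andP[Mi Ni].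
- by rewrite gN.
- by rewrite fM.
- by rewrite fM // gN // addr0.
Qed.

Lemma isumB f g : fin_supp f -> fin_supp g ->
  isum (fun i => f i - g i) = isum f - isum g.
Proof.
move=> [M fM] [N gN].
rewrite !(@isumE (maxn M N)) ?sumrB // => i; rewrite geq_max => /andP[Mi Ni].
- by rewrite gN.
- by rewrite fM.
- by rewrite fM // gN // subr0.
Qed.

Lemma isum_mulrz f n : fin_supp f -> isum f *~ n = isum (fun i => f i *~ n).
Proof.
move=> [N fN]; rewrite !(@isumE N) ?mulrz_suml // => i /fN -> //.
exact: mul0rz.
Qed.

Lemma fin_supp_sum n F : (forall l, fin_supp (F l)) ->
  fin_supp (fun i => \sum_(l < n) F l i).
Proof.
move=> FN; elim: n => [|n IHn]; first by exists 0%N => i _; rewrite big_ord0.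
have [N HN] := fin_suppD IHn (FN n).
by exists N => i /HN; rewrite big_ord_recr.
Qed.

Lemma isum_sum n F : (forall l, fin_supp (F l)) ->
  isum (fun i => \sum_(l < n) F l i) = \sum_(l < n) isum (F l).
Proof.
move=> FN; elim: n => [|n IHn].
  by rewrite big_ord0; apply: isum0 => i; rewrite big_ord0.
under eq_isum do rewrite big_ord_recr.
by rewrite big_ord_recr /= isumD ?IHn //; apply: fin_supp_sum.
Qed.

Lemma isum_shift k f : fin_supp f -> (forall i, (i < k)%N -> f i = 0) ->
  isum f = isum (fun i => f (i + k)%N).
Proof.
move=> [N fN] f0; rewrite (@isumE (k + N)) => [|i le_i]; last first.
  by apply: fN; apply: leq_trans le_i; apply: leq_addl.
rewrite (@isumE N) => [|i le_i]; last by apply/fN/leq_trans/leq_addr.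
rewrite big_split_ord /= big1 ?add0r => [|i _]; last exact/f0.
by apply: eq_bigr => i _; rewrite addnC.
Qed.

(** One bound for both indices, so that iterated sums become sums over a finite square and can be
    exchanged. *)
Definition box_supp F :=
  exists N : nat, forall i j, (N <= i)%N || (N <= j)%N -> F i j = 0.

Lemma box_suppP F :
  (exists M : nat, forall i j, (M <= i)%N -> F i j = 0) ->
  (forall i, fin_supp (F i)) -> box_supp F.
Proof.
move=> [M FM] F0.
have [N FN] : exists N, forall i j, (i < M)%N -> (N <= j)%N -> F i j = 0.
  elim: M {FM} => [|M [N FN]]; first by exists 0%N.
  have [N' FN'] := F0 M; exists (maxn N N') => i j.
  rewrite ltnS geq_max leq_eqVlt => /orP[/eqP->|lt_iM] /andP[Nj N'j].
    exact: FN'.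
  exact: FN.
exists (maxn M N) => i j; rewrite !geq_max.
have [le_Mi _|lt_iM] := leqP M i; first by rewrite FM.
by move=> /andP[_]; apply: FN.
Qed.

Lemma box_supp_fin F : box_supp F -> fin_supp (fun i => isum (F i)).
Proof.
move=> [N FN]; exists N => i le_Ni; apply: isum0 => j.
by rewrite FN // le_Ni.
Qed.

Lemma box_suppT F : box_supp F -> box_supp (fun i j => F j i).
Proof. by move=> [N FN]; exists N => i j; rewrite orbC => /FN. Qed.

Lemma isum_exchange F : box_supp F ->
  isum (fun i => isum (F i)) = isum (fun j => isum (F^~ j)).
Proof.
move=> [N FN].
have E G : (forall i j, (N <= i)%N || (N <= j)%N -> G i j = 0) ->
    isum (fun i => isum (G i)) = \sum_(i < N) \sum_(j < N) G i j.
  move=> GN; rewrite (@isumE N); last first.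
    by move=> i le_Ni; apply: isum0 => j; rewrite GN // le_Ni.
  by apply: eq_bigr => i _; rewrite (@isumE N) // => j le_Nj; rewrite GN // le_Nj orbT.
rewrite !E //; first exact: exchange_big.
by move=> i j; rewrite orbC => /FN.
Qed.

Lemma sum_antidiagonal F M :
  \sum_(s < M) \sum_(i < s.+1) F i (s - i)%N = \sum_(i < M) \sum_(j < M - i) F i j.
Proof.
elim: M => [|M IHM]; first by rewrite !big_ord0.
rewrite big_ord_recr /= IHM [RHS]big_ord_recr /= subSnn big_ord1.
rewrite [X in _ + X = _]big_ord_recr /= subnn addrA -big_split /=; congr (_ + _).
by apply: eq_bigr => i _; rewrite subSn ?big_ord_recr //; apply: ltnW.
Qed.

(** A support inside an N by N square lies in i + j < 2N, so both sides are the same finite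
    triangular sum. *)
Lemma isum_antidiagonal F : box_supp F ->
  isum (fun i => isum (F i)) = isum (fun s => \sum_(i < s.+1) F i (s - i)%N).
Proof.
move=> [N FN]; pose M := (N + N)%N.
have F0 i j : (M <= i + j)%N -> F i j = 0.
  by move=> le_M; apply: FN; rewrite /M in le_M; lia.
rewrite (@isumE M) => [|i le_i]; last first.
  by apply: isum0 => j; apply/F0/leq_trans/leq_addr.
rewrite [RHS](@isumE M) => [|s le_s]; last first.
  by rewrite big1 // => i _; rewrite F0 // subnKC // -ltnS.
rewrite sum_antidiagonal; apply: eq_bigr => i _; apply: isumE => j.
by rewrite leq_subLR => /F0.
Qed.

End InfiniteSums.

Lemma raddf_isum (V W : zmodType) (h : {additive V -> W}) (f : nat -> V) :
  fin_supp f -> h (isum f) = isum (fun i => h (f i)).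
Proof.
move=> [N fN]; rewrite !(@isumE _ N) ?raddf_sum // => i /fN ->.
exact: raddf0.
Qed.

(** * Fields and their products *)

Section Fields.
Variables (k : comPzRingType) (V : lmodType k).

(** The series a(z) = sum_n a(n) z^(-n-1). Both properties are propositions, so a field is
    determined by its modes ([vfieldP]). *)
Record vfield := VField {
  modes :> int -> V -> V;
  modes_linear : forall n, linear (modes n);
  modes_trunc : forall w, exists N : nat, forall n : int, N%:Z <= n -> modes n w = 0 }.

HB.instance Definition _ (a : vfield) n :=
  GRing.isLinear.Build k V V *:%R (modes a n) (modes_linear a n).

Lemma vfieldP (a b : vfield) : (forall n w, a n w = b n w) -> a = b.
Proof.
move=> ab; have {ab} : modes a = modes b by apply/funext => n; apply/funext.
case: a b => [a la ta] [b lb tb] /= ab; case: _ / ab lb tb => lb tb.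
by rewrite (Prop_irrelevance la lb) (Prop_irrelevance ta tb).
Qed.

HB.instance Definition _ := gen_eqMixin vfield.
HB.instance Definition _ := gen_choiceMixin vfield.

Program Definition vfield0 := @VField (fun _ _ => 0) _ _.
Next Obligation. by move=> n x u v; rewrite scaler0 addr0. Qed.
Next Obligation. by exists 0%N. Qed.

Program Definition vfieldD (a b : vfield) := @VField (fun n w => a n w + b n w) _ _.
Next Obligation. by move=> a b n x u v; rewrite !linearP scalerDr addrACA. Qed.
Next Obligation.
move=> a b w; have [M aM] := modes_trunc a w; have [N bN] := modes_trunc b w.
by exists (maxn M N) => n le_n; rewrite aM ?bN ?addr0 //; lia.
Qed.

Program Definition vfieldN (a : vfield) := @VField (fun n w => - a n w) _ _.
Next Obligation. by move=> a n x u v; rewrite linearP opprD scalerN. Qed.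
Next Obligation.
by move=> a w; have [N aN] := modes_trunc a w; exists N => n /aN->; rewrite oppr0.
Qed.

Program Definition vfieldZ (x : k) (a : vfield) := @VField (fun n w => x *: a n w) _ _.
Next Obligation.
by move=> x a n y u v; rewrite linearP scalerDr !scalerA mulrC.
Qed.
Next Obligation.
by move=> x a w; have [N aN] := modes_trunc a w; exists N => n /aN->; rewrite scaler0.
Qed.

Fact vfieldDA : associative vfieldD.
Proof. by move=> a b c; apply: vfieldP => n w; rewrite /= addrA. Qed.
Fact vfieldDC : commutative vfieldD.
Proof. by move=> a b; apply: vfieldP => n w; rewrite /= addrC. Qed.
Fact vfield0D : left_id vfield0 vfieldD.
Proof. by move=> a; apply: vfieldP => n w; rewrite /= add0r. Qed.
Fact vfieldND : left_inverse vfield0 vfieldN vfieldD.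
Proof. by move=> a; apply: vfieldP => n w; rewrite /= addNr. Qed.
HB.instance Definition _ :=
  GRing.isZmodule.Build vfield vfieldDA vfieldDC vfield0D vfieldND.

Fact vfieldZA x y a : vfieldZ x (vfieldZ y a) = vfieldZ (x * y) a.
Proof. by apply: vfieldP => n w; rewrite /= scalerA. Qed.
Fact vfield1Z : left_id 1 vfieldZ.
Proof. by move=> a; apply: vfieldP => n w; rewrite /= scale1r. Qed.
Fact vfieldZDr : right_distributive vfieldZ +%R.
Proof. by move=> x a b; apply: vfieldP => n w; rewrite /= scalerDr. Qed.
Fact vfieldZDl a : {morph vfieldZ^~ a : x y / x + y}.
Proof. by move=> x y; apply: vfieldP => n w; rewrite /= scalerDl. Qed.
HB.instance Definition _ :=
  GRing.Zmodule_isLmodule.Build k vfield vfieldZA vfield1Z vfieldZDr vfieldZDl.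

Definition feval n w (a : vfield) : V := a n w.
Fact feval_linear n w : linear (feval n w).
Proof. by []. Qed.
HB.instance Definition _ n w :=
  GRing.isLinear.Build k vfield V *:%R (feval n w) (feval_linear n w).

Lemma modesD (a b : vfield) n w : (a + b) n w = a n w + b n w.
Proof. by []. Qed.
Lemma modesZ x (a : vfield) n w : (x *: a) n w = x *: a n w.
Proof. by []. Qed.
Lemma modesB (a b : vfield) n w : (a - b) n w = a n w - b n w.
Proof. by []. Qed.
Lemma modesMz (a : vfield) q n w : (a *~ q) n w = a n w *~ q.
Proof. exact: (raddfMz (feval n w)). Qed.
Lemma modes_sum (I : Type) (r : seq I) (P : pred I) (F : I -> vfield) n w :
  (\sum_(i <- r | P i) F i) n w = \sum_(i <- r | P i) F i n w.
Proof. exact: (raddf_sum (feval n w)). Qed.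

Implicit Types (a b c : vfield) (m n p t r : int).

Lemma modes_fin_supp a p w :
  exists N : nat, forall i, (N <= i)%N -> a (p + i%:Z) w = 0.
Proof.
have [N aN] := modes_trunc a w; exists (N + `|p|)%N => i le_i.
by apply: aN; lia.
Qed.

(** The bound is uniform in i because a(i)w is nonzero for only finitely many i >= 0. It gives the
    truncation of [rho] and the exchange of sums in [lam_rho_comm]. *)
Lemma modes_trunc_modes a c w :
  exists N : nat, forall (i : nat) n, N%:Z <= n -> c n (a i w) = 0.
Proof.
have [M aM] := modes_trunc a w.
have [N cN] : exists N : nat, forall (i : nat) n, (i < M)%N -> N%:Z <= n -> c n (a i w) = 0.
  elim: M {aM} => [|M [N cN]]; first by exists 0%N.
  have [N' cN'] := modes_trunc c (a M w); exists (maxn N N') => i n.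
  rewrite ltnS leq_eqVlt => /orP[/eqP->|lt_iM] le_n; first by apply: cN'; lia.
  by apply: cN => //; lia.
exists N => i n le_n; have [le_Mi|/cN->//] := leqP M i.
by rewrite aM ?linear0.
Qed.

(** The coefficients of the expansion of (1 - x)^t. *)
Definition sbin (t : int) (i : nat) : int := (-1) ^+ i * binz t i.

(* The two halves of the t-th product, kept apart because the operators lam a t
   and rho b n commute. *)
Definition lam_modes a t c p w :=
  isum (fun i => a (t - i%:Z) (c (p + i%:Z) w) *~ sbin t i).
Definition rho_modes a t c p w :=
  isum (fun i => c (t + p - i%:Z) (a i w) *~ sbin t i).

Lemma lam_fin_supp a t c p w :
  fin_supp (fun i => a (t - i%:Z) (c (p + i%:Z) w) *~ sbin t i).
Proof.
by have [N cN] := modes_fin_supp c p w; exists N => i /cN->; rewrite linear0 mul0rz.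
Qed.

Lemma rho_fin_supp a t c p w :
  fin_supp (fun i => c (t + p - i%:Z) (a i w) *~ sbin t i).
Proof.
have [N aN] := modes_trunc a w; exists N => i le_i.
by rewrite aN // linear0 mul0rz.
Qed.

Lemma isum_linear (f : V -> nat -> V) :
  (forall w, fin_supp (f w)) -> (forall i, linear (f^~ i)) ->
  linear (fun w => isum (f w)).
Proof.
move=> fN lf x u v.
have -> : x *: isum (f u) = isum (fun i => x *: f u i).
  exact: (raddf_isum ( *:%R x) (fN u)).
rewrite -isumD //; first by apply: eq_isum => i; rewrite lf.
by have [N HN] := fN u; exists N => i /HN->; rewrite scaler0.
Qed.

Program Definition lam a t c := @VField (lam_modes a t c) _ _.
Next Obligation.
move=> a t c p; apply: isum_linear => [w|i x u v]; first exact: lam_fin_supp.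
by rewrite !linearP mulrzDl scalerMzr.
Qed.
Next Obligation.
move=> a t c w; have [N cN] := modes_trunc c w; exists N => p le_p.
by apply: isum0 => i; rewrite cN ?linear0 ?mul0rz //; lia.
Qed.

Program Definition rho a t c := @VField (rho_modes a t c) _ _.
Next Obligation.
move=> a t c p; apply: isum_linear => [w|i x u v]; first exact: rho_fin_supp.
by rewrite !linearP mulrzDl scalerMzr.
Qed.
Next Obligation.
move=> a t c w; have [M aM] := modes_trunc a w.
have [N cN] := modes_trunc_modes a c w.
exists (N + M + `|t|)%N => p le_p; apply: isum0 => i.
have [le_Mi|lt_iM] := leqP M i; first by rewrite aM // linear0 mul0rz.
by rewrite cN ?mul0rz //; lia.
Qed.

(* The coefficient of z^(-p-1) in
   Res_x ((x - z)^t a(x) c(z) - (-z + x)^t c(z) a(x)). *)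
Definition nprod a t c : vfield := lam a t c - rho a t c *~ (-1) ^ t.

(** With the modes of a shifted by r and p = s, this is the right side of [vr_jacobi]. *)
Lemma nprodE a t c p w : nprod a t c p w =
  isum (fun i => (a (t - i%:Z) (c (p + i%:Z) w)
        - c (p + t - i%:Z) (a i w) *~ (-1) ^ t) *~ sbin t i).
Proof.
rewrite /nprod modesB modesMz /= /lam_modes /rho_modes isum_mulrz; last first.
  exact: rho_fin_supp.
rewrite -isumB; first by apply: eq_isum => i; rewrite mulrzBl [p + t]addrC mulrzAC.
  exact: lam_fin_supp.
by have [N HN] := rho_fin_supp a t c p w; exists N => i /HN->; rewrite mul0rz.
Qed.

Lemma nprod_fin_supp a t c p w :
  fin_supp (fun i => (a (t - i%:Z) (c (p + i%:Z) w)
        - c (p + t - i%:Z) (a i w) *~ (-1) ^ t) *~ sbin t i).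
Proof.
have [N HN] := lam_fin_supp a t c p w; have [M HM] := rho_fin_supp a t c p w.
exists (maxn M N) => i; rewrite geq_max => /andP[/HM Mi /HN Ni].
by rewrite mulrzBl Ni [p + t]addrC mulrzAC Mi mul0rz subr0.
Qed.

Lemma fin_suppZ (x : k) (f : nat -> V) : fin_supp f -> fin_supp (fun i => x *: f i).
Proof. by move=> [N HN]; exists N => i /HN->; rewrite scaler0. Qed.

Lemma isumZ (x : k) (f : nat -> V) :
  fin_supp f -> x *: isum f = isum (fun i => x *: f i).
Proof. exact: (raddf_isum ( *:%R x)). Qed.

Lemma lam_linearr a t : linear (lam a t).
Proof.
move=> x c d; apply: vfieldP => p w; rewrite /= /lam_modes.
rewrite isumZ -?isumD; try by do ?apply: fin_suppZ; apply: lam_fin_supp.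
by apply: eq_isum => i; rewrite modesD modesZ modes_linear mulrzDl scalerMzr.
Qed.
HB.instance Definition _ a t :=
  GRing.isLinear.Build k vfield vfield *:%R (lam a t) (lam_linearr a t).

Lemma rho_linearr a t : linear (rho a t).
Proof.
move=> x c d; apply: vfieldP => p w; rewrite /= /rho_modes.
rewrite isumZ -?isumD; try by do ?apply: fin_suppZ; apply: rho_fin_supp.
by apply: eq_isum => i; rewrite modesD modesZ mulrzDl scalerMzr.
Qed.
HB.instance Definition _ a t :=
  GRing.isLinear.Build k vfield vfield *:%R (rho a t) (rho_linearr a t).

Lemma nprod_linearr a t : linear (nprod a t).
Proof.
move=> x c d; rewrite /nprod !linearP mulrzDl scalerMzr scalerBr.
by rewrite opprD addrACA.
Qed.
HB.instance Definition _ a t :=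
  GRing.isLinear.Build k vfield vfield *:%R (nprod a t) (nprod_linearr a t).

Lemma nprod_linearl t c : linear (fun a => nprod a t c).
Proof.
move=> x a b; apply: vfieldP => p w; rewrite [RHS]modesD modesZ !nprodE.
rewrite isumZ -?isumD; try by do ?apply: fin_suppZ; apply: nprod_fin_supp.
apply: eq_isum => i; rewrite !modesD !modesZ modes_linear.
rewrite -scalerMzr -mulrzDl; congr (_ *~ _).
by rewrite scalerBr -scalerMzr mulrzDl opprD addrACA.
Qed.

End Fields.

Lemma raddf_isumMz (V W : zmodType) (h : {additive V -> W}) (f : nat -> V) q :
  fin_supp f -> h (isum f) *~ q = isum (fun i => h (f i) *~ q).
Proof.
move=> fN; rewrite raddf_isum // isum_mulrz //.
by have [N HN] := fN; exists N => i /HN->; rewrite raddf0.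
Qed.

Lemma signzD (m n : int) : (-1 : int) ^ (m + n) = (-1) ^ m * (-1) ^ n.
Proof. by rewrite exprzDr // unitrN1. Qed.

Lemma signzE (n : int) : (-1 : int) ^ n = (-1) ^+ `|n|%N.
Proof. by case: n => n; rewrite /exprz // invr_sign. Qed.

Lemma signzN (n : int) : (-1 : int) ^ (- n) = (-1) ^ n.
Proof. by rewrite !signzE abszN. Qed.

(** * The commutator formula for products of fields *)

Section Commutator.
Variables (k : comPzRingType) (V : lmodType k).
Implicit Types (a b c : vfield V) (m n p t r : int).

(** The modes of a are applied after those of c and the modes of b before them, so the two double
    sums have the same terms and differ only in the order of summation. *)
Lemma lam_rho_comm a b c m n : lam a m (rho b n c) = rho b n (lam a m c).
Proof.
apply: vfieldP => p w /=; rewrite /lam_modes /rho_modes.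
pose F i j := a (m - i%:Z) (c (n + p - j%:Z + i%:Z) (b j w)) *~ (sbin n j * sbin m i).
rewrite (eq_isum (g := fun i => isum (F i))) => [|i]; last first.
  rewrite /= /rho_modes raddf_isumMz; last exact: rho_fin_supp.
  apply: eq_isum => j; rewrite raddfMz -mulrzA /F; congr (a _ (c _ _) *~ _); ring.
rewrite [RHS](eq_isum (g := fun j => isum (F^~ j))) => [|j]; last first.
  rewrite /= /lam_modes isum_mulrz; last exact: lam_fin_supp.
  by apply: eq_isum => i; rewrite -mulrzA mulrC.
apply: isum_exchange.
have [M bM] := modes_trunc b w; have [N cN] := modes_trunc_modes b c w.
exists (M + N + `|(n + p)%R|)%N => i j; have [le_Mj _|lt_jM] := leqP M j.
  by rewrite /F bM // !linear0 mul0rz.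
by move=> le_ij; rewrite /F cN ?linear0 ?mul0rz //; lia.
Qed.

Variables (a b : vfield V) (d : nat -> vfield V) (N : nat).
Hypothesis ab_comm : forall m n w,
  a m (b n w) - b n (a m w) = \sum_(l < N) d l (m + n - l%:Z) w *~ binz m l.

(** Subtracting the double sums leaves the commutators of a(m - i) and b(n - j), to which [ab_comm]
    applies termwise. The terms are then collected by s = i + j. *)
Lemma lam_lam_comm m n c : lam a m (lam b n c) - lam b n (lam a m c)
  = \sum_(l < N) lam (d l) (m + n - l%:Z) c *~ binz m l.
Proof.
apply: vfieldP => p w; rewrite modesB modes_sum /= /lam_modes.
have [M cM] := modes_fin_supp c p w.
have box (f : int -> nat -> nat -> V -> V) (q : nat -> nat -> int) :
    (forall p i j, f p i j 0 = 0) ->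
    box_supp (fun i j => f p i j (c (p + (i + j)%N%:Z) w) *~ q i j).
  by move=> f0; exists M => i j le_ij; rewrite cM ?f0 ?mul0rz //; lia.
pose F a b m n i j :=
  (a : vfield V) (m - i%:Z) ((b : vfield V) (n - j%:Z) (c (p + (i + j)%N%:Z) w))
    *~ (sbin n j * sbin m i).
have Fbox a' b' m' n' : box_supp (F a' b' m' n').
  by apply: (box (fun _ i j w => a' (m' - i%:Z) (b' (n' - j%:Z) w))) => *; rewrite !linear0.
have E a' b' m' n' :
  isum (fun i => a' (m' - i%:Z) (lam b' n' c (p + i%:Z) w) *~ sbin m' i)
    = isum (fun i => isum (F a' b' m' n' i)).
  apply: eq_isum => i; rewrite /= /lam_modes raddf_isumMz; last exact: lam_fin_supp.
  by apply: eq_isum => j; rewrite raddfMz -mulrzA /F PoszD addrA.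
rewrite (E a b) (E b a) (isum_exchange (Fbox b a n m)).
have Fin a' b' m' n' i : fin_supp (F a' b' m' n' i).
  by have [K HK] := Fbox a' b' m' n'; exists K => j le_j; rewrite HK // le_j orbT.
rewrite -isumB; first last.
- exact/box_supp_fin/box_suppT.
- exact: box_supp_fin.
(* The l-th summand of the commutator of a(m - i) and b(n - j). *)
pose G l i j := d l (m + n - l%:Z - (i + j)%N%:Z) (c (p + (i + j)%N%:Z) w)
    *~ (binz (m - i%:Z) l * (sbin n j * sbin m i)).
have Gbox l : box_supp (G l).
  by apply: (box (fun _ i j w => d l (m + n - l%:Z - (i + j)%N%:Z) w)) => *; rewrite linear0.
rewrite (eq_isum (g := fun i => \sum_(l < N) isum (G l i))) => [|i]; last first.
  rewrite -isumB //; last first.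
    by have [K HK] := Fbox b a n m; exists K => j le_j; rewrite HK // le_j.
  rewrite -(isum_sum N (F := fun l j => G l i j)) => [|l]; last first.
    by have [K HK] := Gbox l; exists K => j le_j; rewrite HK // le_j orbT.
  apply: eq_isum => j; rewrite /F [(j + i)%N]addnC [sbin m i * _]mulrC -mulrzBl ab_comm.
  rewrite mulrz_suml; apply: eq_bigr => l _; rewrite -mulrzA /G PoszD.
  by congr (d l _ _ *~ _); ring.
rewrite (isum_sum N (F := fun l i => isum (G l i))); last by move=> l; apply: box_supp_fin.
apply: eq_bigr => l _; rewrite isum_antidiagonal // modesMz /= /lam_modes isum_mulrz; last first.
  exact: lam_fin_supp.
apply: eq_isum => s; rewrite -mulrzA.
transitivity (d l (m + n - l%:Z - s%:Z) (c (p + s%:Z) w) *~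
   (\sum_(i < s.+1) binz (m - i%:Z) l * (sbin n (s - i)%N * sbin m i))).
  rewrite mulrz_sumr; apply: eq_bigr => i _.
  by rewrite /G subnKC // -ltnS.
(* Since binom(m, i) binom(m - i, l) = binom(m, l) binom(m - l, i), the sum over i is an instance of
   Vandermonde. *)
congr (_ *~ _); rewrite /sbin (_ : m + n - l%:Z = m - l%:Z + n); last by ring.
rewrite vandermonde mulr_sumr mulr_suml; apply: eq_bigr => [[i /= lt_is]] _.
rewrite -[X in (-1) ^+ X * (_ * _) * _](@subnK i s) // exprD.
transitivity ((-1) ^+ (s - i) * (-1) ^+ i * binz n (s - i) * (binz m i * binz (m - i%:Z) l)).
  by ring.
by rewrite binz_mul; ring.
Qed.

(** The modes of a and b now act first and in reversed order, which produces the minus sign; the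
    sign (-1)^l comes from shifting the summation index by l. *)
Lemma rho_rho_comm m n c : rho a m (rho b n c) - rho b n (rho a m c)
  = \sum_(l < N) rho (d l) (m + n - l%:Z) c *~ (- (-1) ^+ l * binz m l).
Proof.
apply: vfieldP => p w; rewrite modesB modes_sum /= /rho_modes.
pose F a b m n i j :=
  c (m + n + p - (i + j)%N%:Z) ((b : vfield V) j ((a : vfield V) i w)) *~ (sbin n j * sbin m i).
have Fbox a' b' m' n' : box_supp (F a' b' m' n').
  apply: box_suppP => [|i].
    by have [M aM] := modes_trunc a' w; exists M => i j le_i; rewrite /F aM // !linear0 mul0rz.
  by have [M bM] := modes_trunc b' (a' i w); exists M => j le_j; rewrite /F bM // !linear0 mul0rz.
have E a' b' m' n' :
  isum (fun i => rho b' n' c (m' + p - i%:Z) (a' i w) *~ sbin m' i)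
    = isum (fun i => isum (F a' b' m' n' i)).
  apply: eq_isum => i; rewrite /= /rho_modes isum_mulrz; last exact: rho_fin_supp.
  by apply: eq_isum => j; rewrite -mulrzA /F PoszD; congr (c _ _ *~ _); ring.
rewrite (E a b) (E b a) (isum_exchange (Fbox b a n m)).
have Fin a' b' m' n' i : fin_supp (F a' b' m' n' i).
  by have [K HK] := Fbox a' b' m' n'; exists K => j le_j; rewrite HK // le_j orbT.
rewrite -isumB; first last.
- exact/box_supp_fin/box_suppT.
- exact: box_supp_fin.
pose G l i j := c (m + n + p - (i + j)%N%:Z) (d l ((i + j)%N%:Z - l%:Z) w)
    *~ (- binz i l * (sbin n j * sbin m i)).
have Gbox l : box_supp (G l).
  have [M dM] := modes_trunc (d l) w.
  by exists (M + l)%N => i j le_ij; rewrite /G dM ?linear0 ?mul0rz //; lia.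
rewrite (eq_isum (g := fun i => \sum_(l < N) isum (G l i))) => [|i]; last first.
  rewrite -isumB //; last first.
    by have [K HK] := Fbox b a n m; exists K => j le_j; rewrite HK // le_j.
  rewrite -(isum_sum N (F := fun l j => G l i j)) => [|l]; last first.
    by have [K HK] := Gbox l; exists K => j le_j; rewrite HK // le_j orbT.
  apply: eq_isum => j; rewrite /F [(j + i)%N]addnC [sbin m i * _]mulrC -mulrzBl.
  rewrite [n + m]addrC -opprB -raddfB ab_comm raddf_sum mulNrz mulrz_suml -sumrN.
  apply: eq_bigr => l _; rewrite -mulNrz -raddfN -mulrNz raddfMz -mulrzA.
  by rewrite /G PoszD.
rewrite (isum_sum N (F := fun l i => isum (G l i))); last by move=> l; apply: box_supp_fin.
apply: eq_bigr => l _; rewrite isum_antidiagonal // modesMz /= /rho_modes isum_mulrz; last first.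
  exact: rho_fin_supp.
pose q s := \sum_(i < s.+1) (- binz i l * (sbin n (s - i)%N * sbin m i)).
rewrite (eq_isum (g := fun s => c (m + n + p - s%:Z) (d l (s%:Z - l%:Z) w) *~ q s)); last first.
  move=> s; rewrite mulrz_sumr; apply: eq_bigr => i _.
  by rewrite /G subnKC // -ltnS.
(* For s < l every i <= s has binom(i, l) = 0, so the sum starts at s = l. *)
rewrite (@isum_shift _ l); first last.
- move=> s lt_sl; rewrite /q big1 // => i _.
  by rewrite binz_small ?oppr0 ?mul0r //; have := ltn_ord i; lia.
- have [M dM] := modes_trunc (d l) w.
  by exists (M + l)%N => i le_i; rewrite dM ?linear0 ?mul0rz //; lia.
apply: eq_isum => s; rewrite -mulrzA PoszD; congr (c _ (d l _ _) *~ _); try by ring.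
rewrite /q -addSn addnC big_split_ord /= big1 ?add0r => [|i _]; last first.
  by rewrite binz_small ?oppr0 ?mul0r //; have := ltn_ord i; lia.
rewrite /sbin (_ : m + n - l%:Z = m - l%:Z + n); last by ring.
rewrite vandermonde mulr_sumr mulr_suml; apply: eq_bigr => [[i /= lt_is]] _.
rewrite [(l + i)%N]addnC subnDr.
rewrite -[X in _ = (-1) ^+ X * (_ * _) * _](@subnK i s) // !exprD.
transitivity (- (-1) ^+ (s - i) * (-1) ^+ i * (-1) ^+ l * binz n (s - i)
   * (binz m (i + l) * binz (i + l)%N l)).
  by ring.
by rewrite binz_mul_nat; ring.
Qed.

(** Expanding both products into halves, the mixed terms cancel by [lam_rho_comm]. The pure terms
    recombine because (-1)^(m + n) (-1)^l is the sign that [nprod] attaches to index m + n - l. *)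
Lemma nprod_comm m n c : nprod a m (nprod b n c) - nprod b n (nprod a m c)
  = \sum_(l < N) nprod (d l) (m + n - l%:Z) c *~ binz m l.
Proof.
have E (a' b' : vfield V) m' n' : nprod a' m' (nprod b' n' c)
    = lam a' m' (lam b' n' c) + rho a' m' (rho b' n' c) *~ (-1) ^ (m' + n')
    - (lam a' m' (rho b' n' c) *~ (-1) ^ n' + rho a' m' (lam b' n' c) *~ (-1) ^ m').
  rewrite /nprod !raddfB !raddfMz /= signzD !mulNrz mulrzDl mulNrz -mulrzA mulrC.
  by rewrite !opprD opprK [- (_ *~ _) + _ in LHS]addrC addrACA.
rewrite !E lam_rho_comm (lam_rho_comm b a) [n + m]addrC.
rewrite [_ *~ (-1) ^ m + _]addrC opprB addrA subrK opprD addrACA.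
rewrite lam_lam_comm -mulrzBl rho_rho_comm mulrz_suml -big_split /=.
apply: eq_bigr => l _; rewrite /nprod mulrzBl -!mulrzA -mulrNz; congr (_ + _ *~ _).
rewrite !signzD signzN; have -> : (-1 : int) ^ l%:Z = (-1) ^+ l by [].
by ring.
Qed.

End Commutator.

(** * Products with the identity field and with derivatives *)

Section Derivatives.
Variables (k : comPzRingType) (V : lmodType k).
Implicit Types (a b c : vfield V) (n p t r : int) (m : nat).

Program Definition vid : vfield V := @VField k V (fun n w => if n == -1 then w else 0) _ _.
Next Obligation. by move=> n x u v; case: eqP => //; rewrite scaler0 addr0. Qed.
Next Obligation. by move=> w; exists 0%N => n le_n; case: eqP => //; lia. Qed.

(** The field z^r a(z), which carries the index r of the Jacobi identity. *)
Program Definition vshift r a := @VField k V (fun n => a (r + n)) _ _.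
Next Obligation. by move=> r a n; apply: modes_linear. Qed.
Next Obligation.
move=> r a w; have [N aN] := modes_trunc a w.
by exists (N + `|r|)%N => n le_n; apply: aN; lia.
Qed.

(* The divided power derivative (1/m!) (d/dz)^m a(z). *)
Program Definition dpow m a :=
  @VField k V (fun n w => a (n - m%:Z) w *~ ((-1) ^+ m * binz n m)) _ _.
Next Obligation. by move=> m a n x u v; rewrite linearP mulrzDl scalerMzr. Qed.
Next Obligation.
move=> m a w; have [N aN] := modes_trunc a w.
by exists (N + m)%N => n le_n; rewrite aN ?mul0rz //; lia.
Qed.

(* sbin extended by 0 to negative lower index. *)
Definition sbinI t (j : int) : int := if j is Posz i then sbin t i else 0.

(** The difference of the two expansions of a t-th power of a binomial. For t >= 0 they agree by the
    symmetry of binomial coefficients; for t < 0 at most one of the two terms is nonzero, and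
    negating the upper index evaluates it. *)
Lemma sbinI_sub t p : sbinI t (- 1 - p) - (-1) ^ t * sbinI t (t + p + 1)
  = if t is Negz m then (-1) ^+ m * binz p m else 0.
Proof.
case: t => [n|m]; case: p => [q|i].
- rewrite (_ : -1 - Posz q = Negz q); last by lia.
  rewrite (_ : Posz n + Posz q + 1 = (n + q + 1)%N); last by lia.
  by rewrite /= /sbin binz_small ?mulr0 ?subr0 //; lia.
- rewrite (_ : -1 - Negz i = Posz i) /=; last by lia.
  have [lt_ni|le_in] := ltnP n i.
    rewrite (_ : Posz n + Negz i + 1 = Negz (i - n.+1)%N) /=; last by lia.
    by rewrite /sbin binz_small ?mulr0 ?subr0 //.
  rewrite (_ : Posz n + Negz i + 1 = Posz (n - i)%N) /=; last by lia.
  rewrite /sbin !binz_nat bin_sub // -[X in (-1) ^ Posz X](subnK le_in).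
  rewrite (_ : (-1) ^ Posz (n - i + i)%N = (-1) ^+ (n - i) * (-1) ^+ i :> int); last exact: exprD.
  have s2 : (-1) ^+ (n - i) * (-1) ^+ (n - i) = 1 :> int by rewrite -expr2 sqrr_sign.
  set s := (-1) ^+ (n - i) in s2 *.
  transitivity ((-1) ^+ i * 'C(n, i)%:Z * (1 - s * s)); first by ring.
  by rewrite s2 subrr mulr0.
- rewrite (_ : -1 - Posz q = Negz q) /=; last by lia.
  have [lt_qm|le_mq] := ltnP q m.
    rewrite (_ : Negz m + Posz q + 1 = Negz (m - q.+1)%N) /=; last by lia.
    by rewrite binz_small ?mulr0 ?subr0 //.
  rewrite (_ : Negz m + Posz q + 1 = Posz (q - m)%N) /=; last by lia.
  rewrite /sbin NegzE binzN signzE abszN signrMK.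
  rewrite (_ : Posz m.+1 + Posz (q - m)%N - 1 = Posz q); last by lia.
  rewrite !binz_nat bin_sub // exprS; ring.
- rewrite (_ : -1 - Negz i = Posz i); last by lia.
  rewrite (_ : Negz m + Negz i + 1 = Negz (m + i)%N) /=; last by lia.
  rewrite mulr0 subr0 /sbin !NegzE !binzN !mulrA -!exprD !addnn -!mul2n !exprM sqrrN !expr1n !mul1r.
  rewrite (_ : Posz m.+1 + i%:Z - 1 = (m + i)%N); last by lia.
  rewrite (_ : Posz i.+1 + m%:Z - 1 = (m + i)%N); last by lia.
  by rewrite !binz_nat -[in RHS]bin_sub ?leq_addr // addKn.
Qed.

Lemma lam_vid a t p w : lam a t vid p w = a (t + p + 1) w *~ sbinI t (- 1 - p).
Proof.
rewrite /= /lam_modes; case: p => [q|j].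
  have -> : -1 - Posz q = Negz q by lia.
  by rewrite isum0 // => i; rewrite /= linear0 mul0rz.
rewrite (@isum1 _ j) => [|i neq_ij]; last first.
  by rewrite /= ifF ?linear0 ?mul0rz //; apply/eqP; lia.
have -> : -1 - Negz j = j by lia.
rewrite /= ifT; last by apply/eqP; lia.
by congr (a _ _ *~ _); lia.
Qed.

Lemma rho_vid a t p w : rho a t vid p w = a (t + p + 1) w *~ sbinI t (t + p + 1).
Proof.
rewrite /= /rho_modes; case E: (t + p + 1) => [j|j].
  rewrite (@isum1 _ j) => [|i neq_ij]; last first.
    by rewrite /= ifF ?mul0rz //; apply/eqP; lia.
  by rewrite /= ifT //; apply/eqP; lia.
by rewrite isum0 // => i; rewrite /= ifF ?mul0rz //; apply/eqP; lia.
Qed.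

Lemma nprod_vid a t p w : nprod a t vid p w
  = a (t + p + 1) w *~ (if t is Negz m then (-1) ^+ m * binz p m else 0).
Proof.
rewrite -sbinI_sub /nprod modesB modesMz lam_vid rho_vid mulrzBr -!mulrzA.
by rewrite [sbinI t (t + _ + _) * _]mulrC.
Qed.

Lemma nprod_vid_nat a m : nprod a m vid = 0.
Proof. by apply: vfieldP => p w; rewrite nprod_vid. Qed.

Lemma nprod_vid_neg a m : nprod a (Negz m) vid = dpow m a.
Proof.
apply: vfieldP => p w; rewrite nprod_vid /=; congr (a _ w *~ _); lia.
Qed.

Lemma lam_shift_vid r t c p w :
  lam (vshift r vid) t c p w = c (p + (r + t + 1)) w *~ sbinI t (r + t + 1).
Proof.
rewrite /= /lam_modes /=; case E: (r + t + 1) => [j|j].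
  rewrite (@isum1 _ j) => [|i neq_ij]; last first.
    by rewrite /= ifF ?mul0rz //; apply/eqP; lia.
  by rewrite /= ifT //; apply/eqP; lia.
by rewrite isum0 // => i; rewrite /= ifF ?mul0rz //; apply/eqP; lia.
Qed.

Lemma rho_shift_vid r t c p w :
  rho (vshift r vid) t c p w = c (p + (r + t + 1)) w *~ sbinI t (- 1 - r).
Proof.
rewrite /= /rho_modes /=; case E: (- 1 - r) => [j|j].
  rewrite (@isum1 _ j) => [|i neq_ij]; last first.
    by rewrite /= ifF ?linear0 ?mul0rz //; apply/eqP; lia.
  by rewrite /= ifT; [congr (c _ _ *~ _); lia|apply/eqP; lia].
by rewrite isum0 // => i; rewrite /= ifF ?linear0 ?mul0rz //; apply/eqP; lia.
Qed.

(** Again [sbinI_sub], with the two expansions exchanged by a factor -(-1)^t. For t = -m-1 the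
    product is binom(r, m) z^(r - m) c(z). *)
Lemma nprod_shift_vid r t c p w : nprod (vshift r vid) t c p w
  = c (p + (r + t + 1)) w *~ (if t is Negz m then binz r m else 0).
Proof.
rewrite /nprod modesB modesMz lam_shift_vid rho_shift_vid -mulrzA -mulrzBr.
congr (_ *~ _); have := sbinI_sub t r; rewrite [t + r]addrC.
have s2 : (-1) ^ t * (-1) ^ t = 1 :> int by rewrite signzE -expr2 sqrr_sign.
set s := (-1) ^ t in s2 *; set x := sbinI _ _; set y := sbinI _ _ => E.
transitivity (- s * (x - s * y) - (s * s - 1) * y); first by ring.
rewrite s2 subrr mul0r subr0 E /s; case: (t) => [n|m]; first by rewrite mulr0.
by rewrite signzE /= exprS mulN1r opprK mulrA -expr2 sqrr_sign mul1r.
Qed.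

(** The factor from differentiating a is absorbed into binom(t, i), separately in the two halves of
    the product. *)
Lemma nprod_der a t c : nprod (dpow 1 a) t c = nprod a (t - 1) c *~ (- t).
Proof.
apply: vfieldP => p w; rewrite /nprod modesMz !modesB !modesMz /=.
have -> : lam_modes (dpow 1 a) t c p w = lam_modes a (t - 1) c p w *~ (- t).
  rewrite /lam_modes isum_mulrz; last exact: lam_fin_supp.
  apply: eq_isum => i /=; rewrite -!mulrzA binz1 [_ - _ - 1]addrAC.
  congr (_ *~ _); rewrite /sbin.
  transitivity (- ((-1) ^+ i * (binz t i * (t - i%:Z)))); first by ring.
  by rewrite binz_absorbr; ring.
have -> : rho_modes (dpow 1 a) t c p w = rho_modes a (t - 1) c p w *~ t.
  rewrite /rho_modes isum_mulrz; last exact: rho_fin_supp.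
  (* Mode 0 of a derivative vanishes, so the sum starts at i = 1. *)
  rewrite (@isum_shift _ 1); first last.
  - by case=> // _; rewrite /= binz1 mulr0 mulr0z linear0 mul0rz.
  - exact: (rho_fin_supp (dpow 1 a) t c p w).
  apply: eq_isum => i /=; rewrite raddfMz -!mulrzA binz1 !addn1.
  rewrite (_ : i.+1%:Z - 1 = i%:Z); last by lia.
  rewrite (_ : t + p - i.+1%:Z = t - 1 + p - i%:Z); last by lia.
  congr (_ *~ _); rewrite /sbin expr1 exprS.
  transitivity ((-1) ^+ i * (binz t i.+1 * i.+1%:Z)); first by ring.
  by rewrite binz_absorb; ring.
rewrite mulrzBl -!mulrzA; congr (_ - _ *~ _).
by rewrite signzD signzN expr1z; ring.
Qed.

Lemma isum_unshift i (f : nat -> V) : fin_supp f ->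
  isum (fun j => f (i + j)%N) = isum (fun j => if (i <= j)%N then f j else 0).
Proof.
move=> [N HN]; rewrite [RHS](@isum_shift _ i) => [||j lt_ji]; last 2 first.
- by exists N => j /HN->; case: ifP.
- by rewrite leqNgt lt_ji.
by apply: eq_isum => j; rewrite leq_addl addnC.
Qed.

(** Leibniz rule: the i-th divided derivative of a has been absorbed into its index as (-1)^i
    binom(n, i) a_(n - i). On coefficients this is [binz_mul_nat] followed by [vandermonde_alt]. *)
Lemma dpow_lam m a n c : dpow m (lam a n c)
  = \sum_(i < m.+1) lam a (n - i%:Z) (dpow (m - i) c) *~ sbin n i.
Proof.
apply: vfieldP => p w; rewrite modes_sum /= /lam_modes.
have [N HN] := lam_fin_supp a n c (p - m%:Z) w.
(* J = i + j, with j the summation index of the inner [lam]; the truncated J - i is exact because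
   only i <= J is summed. *)
pose G i J := a (n - J%:Z) (c (p - m%:Z + J%:Z) w) *~
  ((-1) ^+ (m - i) * binz (p + (J - i)%N%:Z) (m - i) * sbin (n - i%:Z) (J - i) * sbin n i).
have GN i : fin_supp (G i).
  have [M HM] := modes_fin_supp c (p - m%:Z) w.
  by exists M => J /HM; rewrite /G => ->; rewrite linear0 mul0rz.
rewrite (eq_bigr (fun i : 'I_m.+1 => isum (fun J => if (i <= J)%N then G i J else 0))) => [|i _].
  rewrite -(isum_sum _ (F := fun i J => if (i <= J)%N then G i J else 0)) => [|i]; last first.
    by have [M HM] := GN i; exists M => J /HM->; case: ifP.
  rewrite isum_mulrz; last exact: lam_fin_supp.
  apply: eq_isum => J; rewrite -mulrzA -big_mkcond /=.
  rewrite /G -mulrz_sumr; congr (_ *~ _).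
  rewrite -(vandermonde_alt J p m) !mulr_sumr.
  rewrite [RHS](big_mkcond) /=; apply: eq_bigr => [[i /= lt_im]] _.
  (* The excluded terms J < i correspond to binom(J, i) = 0. *)
  case: leqP => [le_iJ|lt_Ji]; last by rewrite [binz J i]binz_small // !(mulr0, mul0r).
  rewrite /sbin (_ : p + (J - i)%N%:Z = J%:Z + p - i%:Z); last by rewrite -subzn //; ring.
  have := binz_mul_nat n (J - i) i; rewrite subnK // => E.
  rewrite -[X in _ * binz n J * ((-1) ^+ X * _)](@subnK i m) //.
  rewrite -[X in (-1) ^+ X * binz n J](@subnK i J) // !exprD.
  have s2 : (-1) ^+ i * (-1) ^+ i = 1 :> int by rewrite -expr2 sqrr_sign.
  transitivity ((-1) ^+ (J - i) * ((-1) ^+ i * (-1) ^+ i) * (-1) ^+ (m - i) * (-1) ^+ i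
    * binz (J%:Z + p - i%:Z) (m - i) * (binz n J * binz J i)); first by ring.
  by rewrite s2 E; ring.
rewrite modesMz /= /lam_modes isum_mulrz; last exact: lam_fin_supp.
rewrite -isum_unshift //; apply: eq_isum => j /=.
rewrite raddfMz -!mulrzA /G addKn; congr (a _ (c _ _) *~ _); last by ring.
- by rewrite PoszD; ring.
- by have := ltn_ord i; lia.
Qed.

(** The same rule for the other half. The sign (-1)^i is absent since it comes back from the factor
    (-1)^(n - i) in [nprod]. *)
Lemma dpow_rho m a n c : dpow m (rho a n c)
  = \sum_(i < m.+1) rho a (n - i%:Z) (dpow (m - i) c) *~ binz n i.
Proof.
apply: vfieldP => p w; rewrite modes_sum /= /rho_modes.
rewrite isum_mulrz; last exact: rho_fin_supp.
pose G i j := c (n + (p - m%:Z) - j%:Z) (a j w) *~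
  ((-1) ^+ (m - i) * binz (n - i%:Z + p - j%:Z) (m - i) * sbin (n - i%:Z) j * binz n i).
have [M aM] := modes_trunc a w.
rewrite (eq_bigr (fun i : 'I_m.+1 => isum (G i))) => [|i _].
  rewrite -isum_sum => [|i]; last first.
    by exists M => j le_j; rewrite /G aM // linear0 mul0rz.
  apply: eq_isum => j; rewrite -mulrzA /G -mulrz_sumr; congr (_ *~ _).
  rewrite -(vandermonde_alt (n - j%:Z) p m) !mulr_sumr; apply: eq_bigr => [[i /= lt_im]] _.
  rewrite (_ : n - i%:Z + p - j%:Z = n - j%:Z + p - i%:Z); last by ring.
  rewrite -[X in _ * ((-1) ^+ X * _)](@subnK i m) // !exprD /sbin.
  have s2 : (-1) ^+ i * (-1) ^+ i = 1 :> int by rewrite -expr2 sqrr_sign.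
  transitivity ((-1) ^+ j * ((-1) ^+ i * (-1) ^+ i) * (-1) ^+ (m - i)
    * binz (n - j%:Z + p - i%:Z) (m - i) * (binz n j * binz (n - j%:Z) i)); first by ring.
  by rewrite s2 binz_mul; ring.
rewrite modesMz /= /rho_modes isum_mulrz; last exact: rho_fin_supp.
apply: eq_isum => j /=; rewrite -!mulrzA /G; congr (c _ _ *~ _); last first.
  by rewrite !mulrA.
by have := ltn_ord i; lia.
Qed.

Lemma dpow_nprod m a n c : dpow m (nprod a n c)
  = \sum_(i < m.+1) nprod a (n - i%:Z) (dpow (m - i) c) *~ sbin n i.
Proof.
have E : dpow m (nprod a n c) = dpow m (lam a n c) - dpow m (rho a n c) *~ (-1) ^ n.
  apply: vfieldP => p w; rewrite [RHS]modesB modesMz.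
  transitivity (nprod a n c (p - m%:Z) w *~ ((-1) ^+ m * binz p m)) => //.
  by rewrite /nprod modesB modesMz mulrzBl mulrzAC.
rewrite E dpow_lam dpow_rho mulrz_suml -sumrB; apply: eq_bigr => i _.
rewrite /nprod mulrzBl -!mulrzA; congr (_ - _ *~ _).
have s2 : (-1) ^+ i * (-1) ^+ i = 1 :> int by rewrite -expr2 sqrr_sign.
rewrite signzD signzN (_ : (-1) ^ i%:Z = (-1) ^+ i :> int) // /sbin.
transitivity (binz n i * (-1) ^ n * ((-1) ^+ i * (-1) ^+ i)); last by ring.
by rewrite s2 mulr1.
Qed.

End Derivatives.

(** * The universal property of the vacuum module *)

Lemma kprojZ (k : pzRingType) (V : lmodType k) (O : Type) (act : O -> V -> V)
    (G : V -> Prop) a v :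
  kproj act G (a *: v) = a *: kproj act G v.
Proof. by have := qscaleE act G a v. Qed.

Lemma linear_eq0 (k : pzRingType) (V W : lmodType k) (f : V -> W) :
  linear f -> f 0 = 0.
Proof. by move=> lf; have := lf (-1) 0 0; rewrite scaler0 addr0 scaleN1r addNr. Qed.

Lemma linear_eqZ (k : pzRingType) (V W : lmodType k) (f : V -> W) :
  linear f -> forall a v, f (a *: v) = a *: f v.
Proof. by move=> lf a v; rewrite -[a *: v]addr0 lf linear_eq0 // addr0. Qed.

Section QuotientLift.
Variables (k : pzRingType) (V W : lmodType k) (O : Type) (act : O -> V -> V).
Variables (G : V -> Prop) (f : V -> W).
Hypothesis f_linear : linear f.
Hypothesis f_rel : forall u, gen_submod act G u -> f u = 0.

Definition kquot_lift (q : kquot act G) : W := f (repr q).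

Lemma kquot_liftE v : kquot_lift (kproj act G v) = f v.
Proof.
apply/eqP; rewrite -subr_eq0 addrC -scaleN1r -f_linear scaleN1r addrC.
by apply/eqP/f_rel/kproj_eq; rewrite kprojK.
Qed.

Lemma kquot_lift_is_linear : linear kquot_lift.
Proof.
move=> a p q; rewrite -(kprojK p) -(kprojK q) -linearP !kquot_liftE.
exact: f_linear.
Qed.

End QuotientLift.

Lemma scalerDAC (k : comPzRingType) (W : lmodType k) (a b : k) (p q r s : W) :
  b *: (a *: p + q) + (a *: r + s) = a *: (b *: p + r) + (b *: q + s).
Proof. by rewrite !scalerDr !scalerA [b * a]mulrC addrACA. Qed.

Section InducedModule.
Variables (k : comPzRingType) (g : lmodType k) (br : g -> g -> g).
Variables (h : g -> Prop) (W : lmodType k) (rho : g -> W -> W).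
Local Notation ind := (induced br h rho).
Local Notation it := (ind_tens br h rho).
Implicit Types (s t : seq g) (x y : g) (w : W).

Lemma ind_rel_eq u v : ind_rel br h rho (u - v) -> kproj _ _ u = kproj _ _ v :> ind.
Proof. by move=> Ruv; apply/kproj_eq/gen_submod_gen. Qed.

Lemma ind_tens_addl s x y t w :
  it (s ++ (x + y) :: t) w = it (s ++ x :: t) w + it (s ++ y :: t) w.
Proof.
by rewrite /ind_tens -kprojD; apply: ind_rel_eq; rewrite opprD addrA; apply: ind_addl.
Qed.

Lemma ind_tens_scalel s a x t w :
  it (s ++ (a *: x) :: t) w = a *: it (s ++ x :: t) w.
Proof.
by rewrite /ind_tens -kprojZ; apply: ind_rel_eq; apply: ind_scalel.
Qed.

Lemma ind_tens_scaler s a w : it s (a *: w) = a *: it s w.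
Proof.
by rewrite /ind_tens -kprojZ; apply: ind_rel_eq; apply: ind_scaler.
Qed.

Lemma ind_tens_bracket s x y t w : it (s ++ [:: x, y & t]) w
  = it (s ++ [:: y, x & t]) w + it (s ++ br x y :: t) w.
Proof.
by rewrite /ind_tens -kprojD; apply: ind_rel_eq; rewrite opprD addrA; apply: ind_bracket.
Qed.

Lemma ind_tens_balanced s x w : h x -> it (rcons s x) w = it s (rho x w).
Proof. by move=> hx; apply: ind_rel_eq; apply: ind_balanced. Qed.

Lemma ind_act_tens x s w : ind_act x (it s w) = it (x :: s) w.
Proof. by rewrite /ind_tens ind_actE word_act_tens. Qed.

Lemma ind_tens_ind (P : ind -> Prop) :
  P 0 -> (forall a u v, P u -> P v -> P (a *: u + v)) ->
  (forall s w, P (it s w)) -> forall v, P v.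
Proof.
move=> P0 PD Pt v; rewrite -(kprojK v); elim/kfree_ind: (repr v) => [|a [s w] f Pf].
  by rewrite linear0.
by rewrite linearP; apply: PD => //; apply: Pt.
Qed.

Lemma ind_act0 x : ind_act x 0 = 0 :> ind.
Proof. exact: linear_eq0 (ind_act_is_linear x). Qed.

Lemma ind_act_linear_l (v : ind) : linear (fun x => ind_act x v).
Proof.
move=> a x y; elim/ind_tens_ind: v => [|b u v IHu IHv|s w].
- by rewrite !ind_act0 scaler0 addr0.
- by rewrite !ind_act_is_linear IHu IHv; apply: scalerDAC.
by rewrite !ind_act_tens (ind_tens_addl [::]) (ind_tens_scalel [::]).
Qed.

Lemma ind_act_br x y (v : ind) :
  ind_act x (ind_act y v) = ind_act y (ind_act x v) + ind_act (br x y) v.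
Proof.
elim/ind_tens_ind: v => [|b u v IHu IHv|s w].
- by rewrite !ind_act0 addr0.
- by rewrite !ind_act_is_linear IHu IHv scalerDr addrACA.
by rewrite !ind_act_tens (ind_tens_bracket [::]).
Qed.

End InducedModule.

(** * Virasoro action on the Verma module and on its vacuum quotient *)

Section Verma.
Variables (k : comPzRingType) (c' : k).
Implicit Types (x y : Vir k) (u v : Ver c').

Lemma ver_act_linear_r x : linear (ver_act (c := c') x).
Proof. exact: ind_act_is_linear. Qed.
HB.instance Definition _ x :=
  GRing.isLinear.Build k (Ver c') (Ver c') *:%R (ver_act x) (ver_act_linear_r x).

Lemma ver_act_linear_l v : linear (fun x => ver_act x v).
Proof. exact: ind_act_linear_l. Qed.
Lemma ver_act0l v : ver_act 0 v = 0.
Proof. exact: linear_eq0 (ver_act_linear_l v). Qed.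

Lemma ver_act_br x y v :
  ver_act x (ver_act y v) = ver_act y (ver_act x v) + ver_act (vir_br x y) v.
Proof. exact: ind_act_br. Qed.

Lemma ver_tens_nil w :
  ind_tens (@vir_br k) (@Vir_ge k) (U_act c') [::] w = (w : k) *: ver_v0 c'.
Proof. by rewrite -[in LHS](mulr1 (w : k)); apply: ind_tens_scaler. Qed.

Lemma ver_ge_v0 (x : Vir k) : Vir_ge x ->
  ver_act x (ver_v0 c') = (U_act c' x 1 : k) *: ver_v0 c'.
Proof.
move=> x_ge; rewrite -ver_tens_nil /ver_act ind_act_tens.
exact: (ind_tens_balanced _ _ [::]).
Qed.

Lemma ver_ind (P : Ver c' -> Prop) :
  P 0 -> (forall a u v, P u -> P v -> P (a *: u + v)) ->
  P (ver_v0 c') -> (forall x v, P v -> P (ver_act x v)) -> forall v, P v.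
Proof.
move=> P0 PD Pv0 Pact; apply: ind_tens_ind => // s w.
elim: s => [|x s IHs]; last by rewrite -ind_act_tens; apply: Pact.
by rewrite ver_tens_nil -[_ *: _]addr0; apply: PD.
Qed.

(** K is central and acts by c' on v0, which generates the module. *)
Lemma ver_act_K (v : Ver c') : ver_act (VirK k) v = c' *: v.
Proof.
elim/ver_ind: v => [|a u v IHu IHv||x v IHv].
- by rewrite linear0 scaler0.
- by rewrite ver_act_linear_r IHu IHv scalerDr !scalerA mulrC.
- rewrite ver_ge_v0; first by rewrite /U_act kext_basis; congr (_ *: _); apply: mulr1.
  by apply: gen_submod_gen; left.
have := ver_act_br x (VirK k) v; rewrite vir_br_K ver_act0l addr0 => <-.
by rewrite IHv; apply: linear_eqZ (ver_act_linear_r x) _ _.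
Qed.

Lemma ver_act_VirL_v0 (n : int) : 0 <= n -> ver_act (VirL k n) (ver_v0 c') = 0.
Proof.
move=> n_ge0; rewrite ver_ge_v0; first by rewrite /U_act kext_basis scale0r.
by apply: gen_submod_gen; right; exists n.
Qed.

Lemma M_proj_linear : linear (M_proj (c := c')).
Proof. exact: kproj_is_linear. Qed.

Lemma M_proj0 : M_proj (0 : Ver c') = 0.
Proof. exact: linear_eq0 M_proj_linear. Qed.

Lemma M_projD u v : M_proj (u + v) = M_proj u + M_proj v.
Proof. exact: kprojD. Qed.

Lemma M_projZ a v : M_proj (a *: v) = a *: M_proj v.
Proof. exact: kprojZ. Qed.

Lemma M_proj_surj (q : VirM c') : exists v, q = M_proj v.
Proof. by exists (repr q); rewrite /M_proj kprojK. Qed.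

Lemma M_L_linear n : linear (M_L (c := c') n).
Proof.
move=> a p q; have [u ->] := M_proj_surj p; have [v ->] := M_proj_surj q.
by rewrite -M_proj_linear !M_LE ver_act_linear_r M_proj_linear.
Qed.
HB.instance Definition _ n :=
  GRing.isLinear.Build k (VirM c') (VirM c') *:%R (M_L n) (M_L_linear n).

Lemma M_L_comm m n (q : VirM c') : M_L m (M_L n q) = M_L n (M_L m q) +
  ((m - n)%:~R *: M_L (m + n) q
  + (if m + n == 0 then (binz (m + 1) 3)%:~R *: (c' *: q) else 0)).
Proof.
have [v ->] := M_proj_surj q.
rewrite !M_LE ver_act_br M_projD vir_br_LL ver_act_linear_l M_proj_linear.
congr (_ + (_ + _)); case: ifP => _; last by rewrite ver_act0l M_proj0.
rewrite -[_ *: VirK k]addr0 ver_act_linear_l ver_act0l addr0 ver_act_K.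
by rewrite !M_projZ.
Qed.

Lemma M_L_vac n : -1 <= n -> M_L n (M_vac c') = 0.
Proof.
move=> n_ge; rewrite /M_vac M_LE; have [n0|n0] := leP 0 n.
  by rewrite ver_act_VirL_v0 // M_proj0.
have -> : n = -1 by lia.
rewrite -M_proj0; apply/kproj_eq; rewrite subr0.
exact: gen_submod_gen.
Qed.

Lemma M_omegaE : M_omega c' = M_L (-2) (M_vac c').
Proof. by rewrite /M_vac M_LE. Qed.

(** Since K acts by the scalar c', stability under linear combinations and all L(n) gives stability
    under the whole Virasoro algebra. *)
Lemma VirM_ind (P : VirM c' -> Prop) :
  P 0 -> (forall a p q, P p -> P q -> P (a *: p + q)) ->
  P (M_vac c') -> (forall n q, P q -> P (M_L n q)) -> forall q, P q.
Proof.
move=> P0 PD Pvac PL q; have [v ->] := M_proj_surj q.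
have PZ a p : P p -> P (a *: p) by move=> Pp; rewrite -[a *: p]addr0; apply: PD.
elim/ver_ind: v => [|a u w Pu Pw||x w Pw] //.
- by rewrite M_proj0.
- by rewrite M_proj_linear; apply: PD.
elim/kfree_ind: x => [|a b x IHx]; first by rewrite ver_act0l M_proj0.
rewrite ver_act_linear_l.
rewrite M_proj_linear.
apply: PD IHx.
case: b => [n|]; first by rewrite -M_LE; apply: PL.
by rewrite ver_act_K M_projZ; apply: PZ.
Qed.

End Verma.

(** * Linear maps out of the vacuum module *)

Section Universal.
Variables (k : comPzRingType) (c' : k) (W : lmodType k).
Variables (T : int -> {linear W -> W}) (w0 : W).
Hypothesis T_comm : forall m n w, T m (T n w) - T n (T m w) =
  (m - n)%:~R *: T (m + n) w
  + (if m + n == 0 then (binz (m + 1) 3)%:~R *: (c' *: w) else 0).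
Hypothesis T_vac : forall n, -1 <= n -> T n w0 = 0.

Definition vir_action (x : Vir k) (w : W) : W :=
  kext (fun b : option int => if b is Some n then T n w else c' *: w) x.

Lemma vir_action_linear_l a x y w :
  vir_action (a *: x + y) w = a *: vir_action x w + vir_action y w.
Proof. exact: kext_is_linear. Qed.

Lemma vir_action_basis b w :
  vir_action (kbasis k b) w = if b is Some n then T n w else c' *: w.
Proof. exact: kext_basis. Qed.

Lemma vir_action0 w : vir_action 0 w = 0.
Proof. exact: linear0. Qed.

Lemma vir_actionZ a x w : vir_action (a *: x) w = a *: vir_action x w.
Proof. by rewrite -[a *: x]addr0 vir_action_linear_l vir_action0 addr0. Qed.

Lemma vir_actionD x y w : vir_action (x + y) w = vir_action x w + vir_action y w.
Proof. by rewrite -[in LHS](scale1r x) vir_action_linear_l scale1r. Qed.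

Lemma vir_action_linear_r x : linear (vir_action x).
Proof.
move=> a u v; elim/kfree_ind: x => [|b e x IHx].
  by rewrite !vir_action0 scaler0 addr0.
rewrite !vir_action_linear_l IHx !vir_action_basis -scalerDAC; congr (_ *: _ + _).
by case: e => [n|]; [exact: linearP | rewrite scalerDr !scalerA mulrC].
Qed.
HB.instance Definition _ x :=
  GRing.isLinear.Build k W W *:%R (vir_action x) (vir_action_linear_r x).

(** By bilinearity x and y may be basis elements. For two L's this is [T_comm]; otherwise a scalar
    commutes with a linear map. *)
Lemma vir_action_br x y w : vir_action x (vir_action y w) - vir_action y (vir_action x w)
  = vir_action (vir_br x y) w.
Proof.
elim/kfree_ind: x => [|a b x IHx].
  by rewrite !vir_action0 linear0 subr0 /vir_br linear0 vir_action0.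
rewrite vir_br_linearl !vir_action_linear_l vir_action_linear_r opprD addrACA IHx -scalerBr.
congr (_ *: _ + _) => {x a IHx}; elim/kfree_ind: y => [|a e y IHy].
  rewrite (linear_eq0 (vir_br_linearr _)) !vir_action0.
  by rewrite (linear_eq0 (vir_action_linear_r _)) subrr.
rewrite vir_br_linearr !vir_action_linear_l vir_action_linear_r opprD addrACA IHy -scalerBr.
congr (_ *: _ + _) => {y IHy}; rewrite vir_br_basis !vir_action_basis.
case: b e => [m|] [n|] /=.
- rewrite T_comm vir_action_linear_l vir_action_basis; congr (_ + _).
  by case: eqP => _; rewrite ?vir_action0 // vir_actionZ vir_action_basis.
- by rewrite vir_action0 (linearZ_LR (T m)) subrr.
- by rewrite vir_action0 (linearZ_LR (T n)) subrr.
- by rewrite vir_action0 subrr.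
Qed.

Definition word_eval (s : seq (Vir k)) : W := foldr vir_action w0 s.

Definition tens_eval : kfree k (seq (Vir k) * k^o)%type -> W :=
  kext (fun p => (p.2 : k) *: word_eval p.1).
HB.instance Definition _ := GRing.Linear.on tens_eval.

Lemma tens_evalE s w : tens_eval (tens s w) = (w : k) *: word_eval s.
Proof. exact: kext_basis. Qed.

Lemma foldr_vir_action_linear s : linear (fun w => foldr vir_action w s).
Proof. by elim: s => //= x s IHs a u v; rewrite IHs vir_action_linear_r. Qed.

Lemma U_act_linear w : linear (fun x => U_act c' x w).
Proof. by move=> a x y; apply: kext_is_linear. Qed.

(** The balancedness relation at w0: K acts by c' on both sides, and L(m) with m >= 0 kills w0. The
    factor w is the coordinate in U = k. *)
Lemma vir_action_ge x w : Vir_ge x ->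
  (w : k) *: vir_action x w0 = (U_act c' x w : k) *: w0.
Proof.
elim=> [u||u v _ IHu _ IHv|a v _ IHv|[] //].
- case=> [->|[m m_ge0 ->]]; rewrite /U_act !kext_basis vir_action_basis.
    by rewrite scalerA mulrC.
  by rewrite T_vac ?scaler0 ?scale0r //; lia.
- by rewrite vir_action0 (linear_eq0 (U_act_linear w)) scaler0 scale0r.
- rewrite vir_actionD -[in RHS](scale1r u) (U_act_linear w) scale1r.
  by rewrite scalerDr IHu IHv scalerDl.
- by rewrite vir_actionZ (linear_eqZ (U_act_linear w)) scalerA mulrC -scalerA IHv scalerA.
Qed.

Lemma tens_eval_rel u :
  ind_rel (@vir_br k) (@Vir_ge k) (U_act c') u -> tens_eval u = 0.
Proof.
(* [A s] applies the letters of s. By its linearity, a relation in the middle of a word only has to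
   be checked on the letters to the right of s. *)
pose A s v := foldr vir_action v s.
have AD s v v' : A s (v + v') = A s v + A s v'.
  by have := foldr_vir_action_linear s 1 v v'; rewrite !scale1r.
have AZ s a v : A s (a *: v) = a *: A s v.
  exact: linear_eqZ (foldr_vir_action_linear s) _ _.
have AB s v v' : A s (v - v') = A s v - A s v' by rewrite AD -scaleN1r AZ scaleN1r.
have E s t : word_eval (s ++ t) = A s (word_eval t) by exact: foldr_cat.
have EC s x t : word_eval (s ++ x :: t) = A s (vir_action x (word_eval t)) by exact: E.
case=> [s x y t w|s a x t w|s w w'|s a w|s x y t w|s x w x_ge].
- by rewrite !linearB /= !tens_evalE !EC vir_actionD AD scalerDr addrAC addrK subrr.
- by rewrite linearB linearZ /= !tens_evalE !EC vir_actionZ AZ !scalerA mulrC subrr.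
- by rewrite !linearB /= !tens_evalE scalerDl addrAC addrK subrr.
- by rewrite linearB linearZ /= !tens_evalE scalerA subrr.
- rewrite !linearB /= !tens_evalE !EC /= -vir_action_br AB.
  by rewrite [w *: (_ - _)]scalerBr subrr.
rewrite linearB /= !tens_evalE -cats1 E /=.
by rewrite /word_eval -[foldr _ _ s in X in _ - X]/(A s w0) -!AZ vir_action_ge ?subrr.
Qed.

(** Words are evaluated at w0. The evaluation respects the relations of the induced module, hence
    factors through the Verma module; being equivariant, it kills the submodule generated by L(-1)v0
    because T(-1)w0 = 0. *)
Lemma VirM_universal : exists2 phi : {linear VirM c' -> W},
  phi (M_vac c') = w0 & forall n v, phi (M_L n v) = T n (phi v).
Proof.
have rel1 u : Defs.span (ind_rel (@vir_br k) (@Vir_ge k) (U_act c')) u -> tens_eval u = 0.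
  elim=> [v||u' v _ IHu _ IHv|a v _ IHv|[]//]; first exact: tens_eval_rel.
  - exact: linear0.
  - by rewrite linearD /= IHu IHv addr0.
  - by rewrite linearZ /= IHv scaler0.
pose phi1 : Ver c' -> W := kquot_lift tens_eval.
have phi1E g : phi1 (kproj _ _ g) = tens_eval g by apply: kquot_liftE => //; apply: linearP.
have phi1_lin : linear phi1 by apply: kquot_lift_is_linear => //; apply: linearP.
have phi1_act x v : phi1 (ver_act x v) = vir_action x (phi1 v).
  elim/ind_tens_ind: v => [|a u v IHu IHv|s w].
  - by rewrite (linear_eq0 (ver_act_linear_r x)) (linear_eq0 phi1_lin) linear0.
  - by rewrite ver_act_linear_r !phi1_lin IHu IHv vir_action_linear_r.
  by rewrite /ver_act ind_act_tens /ind_tens !phi1E !tens_evalE (linear_eqZ (vir_action_linear_r x)).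
have phi1_v0 : phi1 (ver_v0 c') = w0 by rewrite phi1E tens_evalE scale1r.
have rel2 u : gen_submod (ver_act (c := c'))
    (fun v => v = ver_act (VirL k (-1)) (ver_v0 c')) u -> phi1 u = 0.
  elim=> [v ->||u' v _ IHu _ IHv|a v _ IHv|x v _ IHv].
  - by rewrite phi1_act phi1_v0 vir_action_basis T_vac.
  - exact: linear_eq0.
  - by rewrite -[u']scale1r phi1_lin IHu IHv scaler0 addr0.
  - by rewrite linear_eqZ // IHv scaler0.
  - by rewrite phi1_act IHv linear0.
pose phi2 : VirM c' -> W := kquot_lift phi1.
have phi2E v : phi2 (M_proj v) = phi1 v by apply: kquot_liftE.
have phi2_lin : linear phi2 by apply: kquot_lift_is_linear.
exists (HB.pack phi2 (GRing.isLinear.Build k _ _ _ phi2 phi2_lin) : {linear VirM c' -> W}).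
  by rewrite /= phi2E.
move=> n q /=; have [v ->] := M_proj_surj q; rewrite M_LE !phi2E phi1_act.
exact: vir_action_basis.
Qed.

End Universal.

(** * The vertex algebra structure *)

Section FieldLemmas.
Variables (k : comPzRingType) (V : lmodType k).
Implicit Types (a b c : vfield V) (n p t r : int).

Lemma nprodDl a b t c : nprod (a + b) t c = nprod a t c + nprod b t c.
Proof. by have := nprod_linearl t c 1 a b; rewrite !scale1r. Qed.

Lemma nprodZl x a t c : nprod (x *: a) t c = x *: nprod a t c.
Proof. exact: linear_eqZ (nprod_linearl t c) _ _. Qed.

Lemma nprodMzl a q t c : nprod (a *~ q) t c = nprod a t c *~ q.
Proof. by rewrite -!scaler_int nprodZl. Qed.

Lemma nprod0l t c : nprod 0 t c = 0.
Proof. exact: linear_eq0 (nprod_linearl t c). Qed.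

Lemma vshift_linear r : linear (vshift (V := V) r).
Proof. by move=> x a b; apply: vfieldP. Qed.
HB.instance Definition _ r :=
  GRing.isLinear.Build k (vfield V) (vfield V) *:%R (vshift r) (vshift_linear r).

Lemma vshift0 a : vshift 0 a = a.
Proof. by apply: vfieldP => n w; rewrite /= add0r. Qed.

Lemma dpow0 a : dpow 0 a = a.
Proof. by apply: vfieldP => n w; rewrite /= subr0 binz0 mulr1z. Qed.

Lemma nprod_vshiftr a t r c : nprod a t (vshift r c) = vshift r (nprod a t c).
Proof.
apply: vfieldP => p w; rewrite [RHS]/= -[RHS]/(nprod a t c (r + p) w) !nprodE.
by apply: eq_isum => i /=; rewrite !addrA.
Qed.

Lemma vshift_dpow1 r a :
  vshift r (dpow 1 a) = dpow 1 (vshift r a) + vshift (r - 1) a *~ (- r).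
Proof.
apply: vfieldP => n w; rewrite modesD modesMz /= !binz1 addrA (addrAC r (-1)).
by rewrite -mulrzDr; congr (_ *~ _); ring.
Qed.

Lemma nprod_vidl t c : nprod (vid V) t c = if t == -1 then c else 0.
Proof.
apply: vfieldP => p w; rewrite -(vshift0 (vid V)) nprod_shift_vid add0r.
case: t => [n|[|m]] //=.
- by rewrite addr0 binz0 mulr1z.
- by rewrite binz_small.
Qed.

End FieldLemmas.

(** * The Virasoro field on an abstract vacuum module *)

Section VirasoroVertexAlgebra.
Variables (k : comPzRingType) (c' : k) (V : lmodType k).
Variables (L : int -> {linear V -> V}) (vac : V).
Hypothesis L_comm : forall m n v, L m (L n v) = L n (L m v) +
  ((m - n)%:~R *: L (m + n) v
  + (if m + n == 0 then (binz (m + 1) 3)%:~R *: (c' *: v) else 0)).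
Hypothesis L_vac : forall n, -1 <= n -> L n vac = 0.
Hypothesis V_ind : forall P : V -> Prop,
  P 0 -> (forall a p q, P p -> P q -> P (a *: p + q)) ->
  P vac -> (forall n q, P q -> P (L n q)) -> forall q, P q.

Lemma L_trunc (v : V) : exists N : nat, forall n : int, N%:Z <= n -> L n v = 0.
Proof.
elim/V_ind: v => [|a u v [M uM] [N vN]||m v [N vN]].
- by exists 0%N => n _; rewrite linear0.
- by exists (maxn M N) => n le_n; rewrite linearP uM ?vN ?scaler0 ?addr0 //; lia.
- by exists 0%N => n le_n; rewrite L_vac //; lia.
(* This bound keeps n and m + n at least N and makes m + n positive, so the cocycle term
   vanishes. *)
exists (N + `|m|).+1 => n le_n; rewrite L_comm vN; last by lia.
rewrite vN; last by lia.
by rewrite linear0 scaler0 !add0r; case: eqP => //; lia.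
Qed.

(** The shift by 1 reconciles the exponent -n-2 of omega(z) with the exponent -n-1 of a field. *)
Program Definition omega : vfield V := @VField k V (fun n => L (n - 1)) _ _.
Next Obligation. by move=> n; apply: linearP. Qed.
Next Obligation.
move=> w; have [N wN] := L_trunc w; exists N.+1 => n le_n; apply: wN; lia.
Qed.

Lemma omega_vac n : 0 <= n -> omega n vac = 0.
Proof. by move=> n_ge0; apply: L_vac; lia. Qed.

(* The products omega_(l) omega.  The entry at 3 is c', not c'/2, because the
   cocycle is binom(m + 1, 3) K. *)
Definition omega_prod (l : nat) : vfield V :=
  match l with
  | 0 => dpow 1 omega
  | 1 => omega + omega
  | 3 => c' *: vid V
  | _ => 0
  end.

(** The structure constant m - n is split as -(m + n) + 2m, between the derivative of omega (l = 0)
    and 2 omega (l = 1). The cocycle is the term l = 3. *)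
Lemma omega_comm m n w : omega m (omega n w) - omega n (omega m w)
  = \sum_(l < 4) omega_prod l (m + n - l%:Z) w *~ binz m l.
Proof.
rewrite !big_ord_recr big_ord0 /= add0r mul0rz addr0.
rewrite L_comm [X in X - _]addrC addrK !binz0 !binz1 mulr1z.
have -> : m - 1 + (n - 1) = m + n - 2 by ring.
have -> : m + n - 0%:Z - 1%:Z - 1 = m + n - 2 by ring.
have -> : m + n - 1%:Z - 1 = m + n - 2 by ring.
congr (_ + _).
  rewrite scaler_int -[X in _ = _ + (X + X) *~ _]mulr1z -mulrzDr -mulrzA -mulrzDr.
  by congr (_ *~ _); ring.
rewrite subrK (_ : (m + n - 2 == 0) = (m + n - 3%:Z == -1)); last by lia.
by case: ifP; rewrite ?scaler_int // scaler0 mul0rz.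
Qed.

(** [nprod_comm] carries [omega_comm] over to products; [nprod_der] and [nprod_vidl] turn its right
    side back into the Virasoro relation. *)
Lemma omega_nprod_comm m n (w : vfield V) :
  nprod omega (m + 1) (nprod omega (n + 1) w)
    - nprod omega (n + 1) (nprod omega (m + 1) w)
  = (m - n)%:~R *: nprod omega (m + n + 1) w
  + (if m + n == 0 then (binz (m + 1) 3)%:~R *: (c' *: w) else 0).
Proof.
rewrite (nprod_comm omega_comm) !big_ord_recr big_ord0 /= add0r.
rewrite nprod0l mul0rz addr0 nprod_der nprodDl nprodZl nprod_vidl !binz0 !binz1 mulr1z.
have -> : m + 1 + (n + 1) - 0%:Z - 1 = m + n + 1 by ring.
have -> : m + 1 + (n + 1) - 1%:Z = m + n + 1 by ring.
congr (_ + _).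
  rewrite scaler_int -[X in _ + (X + X) *~ _]mulr1z -mulrzDr -mulrzA -mulrzDr.
  by congr (_ *~ _); ring.
rewrite (_ : (m + 1 + (n + 1) - 3%:Z == -1) = (m + n == 0)); last by lia.
by case: ifP; rewrite ?scaler_int // scaler0 mul0rz.
Qed.

(** * The state-field map and the Jacobi identity *)

Variable Y : {linear V -> vfield V}.
Hypothesis Y_vac : Y vac = vid V.
Hypothesis Y_omega_act : forall n v, Y (omega n v) = nprod omega n (Y v).

Lemma ind_omega (P : V -> Prop) :
  P 0 -> (forall a p q, P p -> P q -> P (a *: p + q)) ->
  P vac -> (forall n q, P q -> P (omega n q)) -> forall q, P q.
Proof.
move=> P0 PD Pvac PL; apply: (V_ind P0 PD Pvac) => n q Pq.
by have := PL (n + 1) q Pq; rewrite /= addrK.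
Qed.

Local Notation conf := (omega (-1) vac).

Lemma Y_conf : Y conf = omega.
Proof. by rewrite Y_omega_act Y_vac (nprod_vid_neg omega 0) dpow0. Qed.

(** The two claims are proved together: in omega_(m) Y(u) applied to the vacuum, the nonnegative
    modes of Y(u) and of omega kill everything but the term i = 0 of mode -1. *)
Lemma Y_creation u : Y u (-1) vac = u /\ forall n, 0 <= n -> Y u n vac = 0.
Proof.
elim/ind_omega: u => [|a u v [IHu IHu'] [IHv IHv']||m u [IHu IHu']].
- by rewrite linear0.
- rewrite linearP modesD modesZ IHu IHv; split=> // n n_ge0.
  by rewrite modesD modesZ IHu' ?IHv' // scaler0 addr0.
- by rewrite Y_vac; split=> // n n_ge0 /=; case: eqP => //; lia.
rewrite Y_omega_act; split=> [|n n_ge0]; rewrite nprodE.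
  rewrite (@isum1 _ 0) => [|i i_neq0]; last first.
    by rewrite IHu' ?omega_vac ?linear0 ?mul0rz ?subr0 ?mul0rz //; lia.
  by rewrite subr0 addr0 IHu omega_vac // linear0 mul0rz subr0 /sbin binz0.
apply: isum0 => i.
by rewrite IHu' ?omega_vac ?linear0 ?mul0rz ?subr0 ?mul0rz //; lia.
Qed.

(** For t = -m-1 this says that u(t)vac is sent to the m-th divided derivative of Y(u). The
    induction on u compares the expansion of Y(omega(p)u)(t)vac with [dpow_nprod]. *)
Lemma Y_mode_vac u t : Y (Y u t vac) = nprod (Y u) t (vid V).
Proof.
case: t => [n|m].
  by have [_ ->] := Y_creation u; rewrite // nprod_vid_nat linear0.
elim/ind_omega: u m => [|a u v IHu IHv||p u IHu] m.
- by rewrite linear0 nprod0l linear0.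
- rewrite linearP modesD modesZ !linearP /= IHu IHv.
  by rewrite nprodDl nprodZl.
- by rewrite Y_vac nprod_vidl; case: m => [|m] /=; rewrite ?Y_vac ?linear0.
have [_ u_vac] := Y_creation u.
(* For i > m the mode -m-1+i of Y(u) is nonnegative and kills the vacuum. *)
rewrite Y_omega_act nprod_vid_neg nprodE (@isumE _ m.+1) => [|i le_i]; last first.
  rewrite u_vac; last by lia.
  by rewrite omega_vac // !linear0 mul0rz subr0 mul0rz.
rewrite raddf_sum dpow_nprod; apply: eq_bigr => i _; have lt_i := ltn_ord i.
rewrite omega_vac // linear0 mul0rz subr0 raddfMz -[X in X *~ _]/(Y _) Y_omega_act.
rewrite (_ : Negz m + i%:Z = Negz (m - i)%N); last by lia.
by rewrite IHu nprod_vid_neg.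
Qed.

(* The Jacobi identity: the field with modes n |-> u(r + n) is z^r Y(u, z),
   so this is the case (r, s, t) for all s and w at once. *)
Definition jacobi u v := forall r t, nprod (vshift r (Y u)) t (Y v)
  = isum (fun i => vshift (r - i%:Z) (Y (Y u (t + i%:Z) v)) *~ binz r i).

Lemma jacobi_fin_supp u v r t :
  fin_supp (fun i => vshift (r - i%:Z) (Y (Y u (t + i%:Z) v)) *~ binz r i).
Proof.
by have [N HN] := modes_fin_supp (Y u) t v; exists N => i /HN->; rewrite !linear0 mul0rz.
Qed.

Lemma jacobi_linearl a u u' v : jacobi u v -> jacobi u' v -> jacobi (a *: u + u') v.
Proof.
move=> Ju Ju' r t; rewrite !linearP /= nprodDl nprodZl Ju Ju'.
rewrite isumZ -?isumD; try by do ?apply: fin_suppZ; apply: jacobi_fin_supp.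
apply: eq_isum => i; rewrite !linearP /=.
by rewrite mulrzDl scalerMzr.
Qed.

Lemma jacobi_linearr a u v v' : jacobi u v -> jacobi u v' -> jacobi u (a *: v + v').
Proof.
move=> Jv Jv' r t; rewrite !linearP /= Jv Jv'.
rewrite isumZ -?isumD; try by do ?apply: fin_suppZ; apply: jacobi_fin_supp.
apply: eq_isum => i; rewrite !linearP /=.
by rewrite mulrzDl scalerMzr.
Qed.

Lemma jacobi0l v : jacobi 0 v.
Proof.
move=> r t; rewrite !linear0 nprod0l isum0 // => i.
by rewrite !linear0 mul0rz.
Qed.

Lemma jacobi0r u : jacobi u 0.
Proof.
move=> r t; rewrite !linear0 isum0 // => i.
by rewrite !linear0 mul0rz.
Qed.

Lemma jacobi_vacl v : jacobi vac v.
Proof.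
move=> r t; apply: vfieldP => p w; rewrite Y_vac nprod_shift_vid.
case: t => [n|m].
  by rewrite isum0 // => i; rewrite /= !linear0 mul0rz.
rewrite (@isum1 _ m) => [|i neq_im]; last first.
  by rewrite /= ifF ?linear0 ?mul0rz //; apply/eqP; lia.
rewrite modesMz /= ifT; last by apply/eqP; lia.
by congr (Y v _ _ *~ _); lia.
Qed.

(** For t = -m-1, by [Y_mode_vac], this is the Leibniz rule for the m-th divided derivative of z^r
    Y(u, z); for t >= 0 both sides vanish. *)
Lemma jacobi_vacr u : jacobi u vac.
Proof.
move=> r t; apply: vfieldP => s w; rewrite Y_vac nprod_vid.
case: t => [n|m].
  rewrite isum0 ?mulr0z // => i.
  by rewrite Y_mode_vac nprod_vid_nat linear0 mul0rz.
rewrite (@isumE _ m.+1) => [|i le_i]; last first.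
  rewrite Y_mode_vac (_ : Negz m + i%:Z = Posz (i - m.+1)%N); last by lia.
  by rewrite nprod_vid_nat linear0 mul0rz.
rewrite modes_sum.
rewrite (eq_bigr (fun i : 'I_m.+1 => Y u (r + (Negz m + s + 1)) w *~
   ((-1) ^+ (m - i) * binz (r + s - i%:Z) (m - i) * binz r i))).
  rewrite -mulrz_sumr; congr (_ *~ _); rewrite -(vandermonde_alt r s m) mulr_sumr.
  apply: eq_bigr => [[i /= lt_i]] _; rewrite -[X in (-1) ^+ X * (_ * _)](@subnK i m) // exprD.
  have s2 : (-1) ^+ i * (-1) ^+ i = 1 :> int by rewrite -expr2 sqrr_sign.
  transitivity (((-1) ^+ i * (-1) ^+ i) * (-1) ^+ (m - i) * binz (r + s - i%:Z) (m - i) * binz r i).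
    by ring.
  by rewrite s2 mul1r.
move=> [i /= lt_i] _; rewrite modesMz Y_mode_vac.
rewrite (_ : Negz m + i%:Z = Negz (m - i)%N); last by lia.
rewrite nprod_vid_neg /= -mulrzA (_ : r - i%:Z + s = r + s - i%:Z); last by ring.
by congr (Y u _ w *~ _); lia.
Qed.

(** Writing z^r a' = (z^r a)' - r z^(r-1) a with a = Y(u) reduces the identity to those for u at (r,
    t - 1) and (r - 1, t). *)
Lemma jacobi_der u u' v : Y u' = dpow 1 (Y u) -> jacobi u v -> jacobi u' v.
Proof.
move=> Yu' Ju r t.
rewrite Yu' vshift_dpow1 nprodDl nprodMzl nprod_der !Ju.
rewrite !isum_mulrz; try exact: jacobi_fin_supp.
(* The factor -(t + i) of the derivative is split into -t and -i, one part for each of the two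
   identities. *)
have E i : vshift (r - i%:Z) (Y (dpow 1 (Y u) (t + i%:Z) v)) *~ binz r i =
    vshift (r - i%:Z) (Y (Y u (t - 1 + i%:Z) v)) *~ binz r i *~ (- t)
  + vshift (r - i%:Z) (Y (Y u (t - 1 + i%:Z) v)) *~ (- (binz r i * i%:Z)).
  rewrite /= binz1 !raddfMz /= -!mulrzA -mulrzDr (addrAC t).
  by congr (_ *~ _); ring.
rewrite [RHS](eq_isum E).
have [N HN] := jacobi_fin_supp u v r (t - 1).
have [M HM] := modes_fin_supp (Y u) (t - 1) v.
rewrite isumD; first last.
- by exists M => i /HM->; rewrite !linear0 mul0rz.
- by exists N => i /HN->; rewrite mul0rz.
congr (_ + _); rewrite [RHS](@isum_shift _ 1); first last.
- by case=> // _; rewrite mulr0 oppr0 mulr0z.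
- by exists M => i /HM->; rewrite !linear0 mul0rz.
apply: eq_isum => i; rewrite addn1 binz_absorb -mulrzA.
rewrite (_ : t - 1 + i.+1%:Z = t + i%:Z); last by lia.
rewrite (_ : r - 1 - i%:Z = r - i.+1%:Z); last by lia.
by congr (_ *~ _); ring.
Qed.

Lemma jacobi_step u v p (N : nat) :
  (forall m n w, omega m (Y u n w) - Y u n (omega m w)
     = \sum_(l < N) Y (omega l u) (m + n - l%:Z) w *~ binz m l) ->
  (forall l : nat, jacobi (omega l u) v) -> jacobi u v -> jacobi u (omega p v).
Proof.
move=> comm Jl Ju r t; rewrite Y_omega_act.
have comm_r m n w : omega m (vshift r (Y u) n w) - vshift r (Y u) n (omega m w)
    = \sum_(l < N) vshift r (Y (omega l u)) (m + n - l%:Z) w *~ binz m l.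
  by rewrite comm; apply: eq_bigr => l _ /=; rewrite !addrA (addrC m).
(* The commutator formula is solved for (z^r Y(u))_(t) omega_(p) Y(v). *)
have /eqP := nprod_comm (d := fun l => vshift r (Y (omega l u))) comm_r p t (Y v).
rewrite subr_eq addrC -subr_eq eq_sym => /eqP->.
rewrite Ju raddf_isum; last exact: jacobi_fin_supp.
pose F (l : nat) i :=
  vshift (r - i%:Z) (Y (Y (omega l u) (p + t - l%:Z + i%:Z) v)) *~ binz r i *~ binz p l.
have FN l : fin_supp (F l).
  have [M HM] := jacobi_fin_supp (omega l u) v r (p + t - l%:Z).
  by exists M => i /HM; rewrite /F => ->; rewrite mul0rz.
rewrite (eq_bigr (fun l : 'I_N => isum (F l))).
  rewrite -isum_sum // -isumB; first last.
  - exact: fin_supp_sum.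
  - have [M HM] := jacobi_fin_supp u v r t.
    by exists M => i /HM->; rewrite raddf0.
  apply: eq_isum => i; rewrite raddfMz /= nprod_vshiftr -Y_omega_act.
  (* The commutator of modes, applied to the vector v, splits the other side in the same way. *)
  have -> : Y u (t + i%:Z) (omega p v) = omega p (Y u (t + i%:Z) v)
      - \sum_(l < N) Y (omega l u) (p + (t + i%:Z) - l%:Z) v *~ binz p l.
    by rewrite -comm subKr.
  rewrite !raddfB /= mulrzBl; congr (_ - _).
  rewrite !raddf_sum /= mulrz_suml; apply: eq_bigr => l _.
  rewrite !raddfMz /= /F mulrzAC.
  by have -> : p + (t + i%:Z) - l%:Z = p + t - l%:Z + i%:Z by ring.
by move=> l _; rewrite Jl isum_mulrz //; apply: jacobi_fin_supp.
Qed.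

Lemma omega_prod_vec (l : nat) : omega l conf =
  match l with
  | 0 => omega (-2) vac
  | 1 => conf + conf
  | 3 => c' *: vac
  | _ => 0
  end.
Proof.
rewrite /= L_comm; case: l => [|[|l]].
- by rewrite (@L_vac (-1)) // linear0 add0r addr0 scale1r.
- by rewrite (@L_vac 0) // linear0 add0r addr0 scaler_int.
rewrite L_vac; last by lia.
rewrite linear0 add0r L_vac; last by lia.
rewrite scaler0 add0r; case: l => [|[|l]].
- by [].
- by rewrite subrK binz_nat scale1r.
by [].
Qed.

Lemma Y_omega_prod (l : nat) : (l < 4)%N -> Y (omega l conf) = omega_prod l.
Proof.
rewrite omega_prod_vec; case: l => [|[|[|[|]]]] // _.
- by rewrite Y_omega_act Y_vac (nprod_vid_neg omega 1).
- by rewrite linearD /= Y_conf.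
- exact: linear0.
- by rewrite linearZ /= Y_vac.
Qed.

(** Induction on v by [jacobi_step]: each omega(l)conf yields the derivative of omega, twice omega,
    a multiple of the identity or 0, so its identity with v follows from that of conf or of the
    vacuum. *)
Lemma jacobi_omega v : jacobi conf v.
Proof.
elim/ind_omega: v => [|a u v Ju Jv||p v Jv].
- exact: jacobi0r.
- exact: jacobi_linearr.
- exact: jacobi_vacr.
refine (@jacobi_step conf v p 4 _ _ Jv) => [m n w|l].
  rewrite Y_conf omega_comm; apply: eq_bigr => l _.
  by rewrite Y_omega_prod.
rewrite omega_prod_vec; case: l => [|[|[|[|l]]]].
- by apply: jacobi_der Jv; rewrite Y_conf Y_omega_act Y_vac (nprod_vid_neg omega 1).
- by rewrite -[X in X + _]scale1r; apply: jacobi_linearl.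
- exact: jacobi0l.
- rewrite -[_ *: _]addr0; apply: jacobi_linearl; [exact: jacobi_vacl | exact: jacobi0l].
- exact: jacobi0l.
Qed.

(** The Jacobi identity at r = m, s = n, t = 0, where the product reduces to its term i = 0. *)
Lemma omega_Y_comm u (N : nat) : (forall l, (N <= l)%N -> omega l u = 0) ->
  forall m n w, omega m (Y u n w) - Y u n (omega m w)
     = \sum_(l < N) Y (omega l u) (m + n - l%:Z) w *~ binz m l.
Proof.
move=> uN m n w; have := congr1 (fun a : vfield V => a n w) (jacobi_omega u m 0).
rewrite Y_conf nprodE (@isum1 _ 0) => [|[//|i] _]; last by rewrite /sbin binz_small // mulr0 mulr0z.
rewrite (@isumE _ N) => [|i /uN]; last by rewrite add0r => ->; rewrite !linear0 mul0rz.
rewrite modes_sum /sbin binz0 /= subr0 !addr0 !mulr1z => ->.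
apply: eq_bigr => l _; rewrite modesMz add0r /=; congr (Y _ _ _ *~ _).
by rewrite addrAC.
Qed.

(** The induction on v keeps u arbitrary, since the step for u uses the identity of every omega(l)u
    with v. *)
Lemma jacobi_all u v : jacobi u v.
Proof.
elim/ind_omega: v u => [|a v v' Jv Jv'||p v Jv] u.
- exact: jacobi0r.
- exact: jacobi_linearr.
- exact: jacobi_vacr.
have [N uN] := modes_trunc omega u.
refine (@jacobi_step u v p N _ (fun l => Jv (omega l u)) (Jv u)).
by apply: omega_Y_comm => l le_l; apply: uN.
Qed.

Lemma Y_is_vertex_algebra : is_vertex_algebra (fun u n v => Y u n v) vac.
Proof.
split; first split.
- by move=> n u u' v; rewrite linearD.
- by move=> n u v v'; rewrite linearD.
- by move=> u v; apply: modes_trunc.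
- by move=> u; have [] := Y_creation u.
- by move=> u; have [] := Y_creation u.
(* Mode s of the field identity, evaluated at w, is the required one. *)
- move=> u v w r s t; have := congr1 (feval s w) (jacobi_all u v r t).
  rewrite raddf_isum; last exact: jacobi_fin_supp.
  rewrite [feval s w _]nprodE => E; symmetry; transitivity (isum (fun i =>
    feval s w (vshift (r - i%:Z) (Y (Y u (t + i%:Z) v)) *~ binz r i))).
    by rewrite -E; apply: eq_isum => i /=; rewrite addrA.
  by apply: eq_isum => i; rewrite raddfMz /= addrAC.
- by move=> n a u v; rewrite linearZ.
- by move=> n a u v; rewrite linearZ.
Qed.

Lemma Y_generates :
  generates (fun u n v => Y u n v) vac (fun u => u = conf).
Proof.
move=> v; elim/ind_omega: v => [|a u v Su Sv||n v].
- exact: gen_submod0.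
- by apply: gen_submodD => //; apply: gen_submodZ.
- by apply: gen_submod_gen; exists [::].
(* The span is stable under omega(n): prefixing (conf, n) to a word applies it. *)
elim=> {v} [v [s Ss ->]||u v _ IHu _ IHv|a v _ IHv|[] //].
- apply: gen_submod_gen; exists ((conf, n) :: s); last by rewrite /= Y_conf.
  by move=> p; rewrite inE => /orP[/eqP->|/Ss].
- by rewrite linear0; apply: gen_submod0.
- by rewrite linearD; apply: gen_submodD.
- by rewrite linearZ; apply: gen_submodZ.
Qed.

End VirasoroVertexAlgebra.

(** * The vertex algebra on the vacuum module *)

Theorem theorem7p3 (k : comPzRingType) (c' : k) :
  exists prod : VirM c' -> int -> VirM c' -> VirM c',
    is_vertex_algebra prod (M_vac c') /\
    generates prod (M_vac c') (fun u => u = M_omega c') /\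
    (forall (j : int) (v : VirM c'), Y prod (M_omega c') j v = omega_field j v).
Proof.
pose L n : {linear VirM c' -> VirM c'} := M_L n.
have L_comm : forall m n v, L m (L n v) = L n (L m v) + ((m - n)%:~R *: L (m + n) v
    + (if m + n == 0 then (binz (m + 1) 3)%:~R *: (c' *: v) else 0)).
  exact: M_L_comm.
have L_vac : forall n, -1 <= n -> L n (M_vac c') = 0 by exact: M_L_vac.
have L_ind := @VirM_ind k c'.
pose w := omega L_comm L_vac L_ind.
(* As L(n) = omega(n + 1) on vectors, L(n) acts on fields by the product of index n + 1. *)
pose T n : {linear vfield (VirM c') -> vfield (VirM c')} := nprod w (n + 1).
have T_comm m n a : T m (T n a) - T n (T m a) = (m - n)%:~R *: T (m + n) a
    + (if m + n == 0 then (binz (m + 1) 3)%:~R *: (c' *: a) else 0).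
  exact: omega_nprod_comm.
(* Here n + 1 >= 0, and nonnegative products with the identity field vanish. *)
have T_vac n : -1 <= n -> T n (vid (VirM c')) = 0.
  by move=> le_n; rewrite /T /=; case E: (n + 1) => [m|m]; [exact: nprod_vid_nat | lia].
have [Yop Y_vac Y_act] := VirM_universal T_comm T_vac.
have Y_act' n v : Yop (w n v) = nprod w n (Yop v).
  by rewrite [w n v]/= Y_act /T /= subrK.
exists (fun u n v => Yop u n v).
have E : M_omega c' = w (-1) (M_vac c') by rewrite M_omegaE.
rewrite E; split; first exact: (Y_is_vertex_algebra Y_vac Y_act').
split; first exact: (Y_generates Y_vac Y_act').
move=> j v; rewrite /Y /omega_field (Y_conf Y_vac Y_act') /=.
by congr (M_L _ v); ring.
Qed.
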